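(* Let $M=M_{1}\times_{f}M_{2}$ be an $n$-dimensional warped product manifold, let $\tilde{M}$ be an $m$-dimensional Riemannian manifold, and let $x:M_{1}\times_{f}M_{2}\rightarrow\tilde{M}$ be an isometric immersion. Put $n_{i}=\dim M_{i}$, $i=1,2$, and let $\Delta$ be the Laplacian operator of $M_{1}$. Then at every point $p\in M$ $$n_{2}\frac{\Delta f}{f}\leq \frac{n^{2}}{4}\Vert H\Vert^{2}+\tilde{\tau}(T_{p}M)-\tilde{\tau}(T_{p}M_{1})-\tilde{\tau}(T_{p}M_{2}).$$ Moreover, equality holds identically (i.e. at every point) if and only if $x$ is a mixed totally geodesic immersion and $n_{1}H_{1}=n_{2}H_{2}$, where $H_{1},H_{2}$ are the partial mean curvature vectors.
   Context: Warped product: given Riemannian manifolds $(M_{1},g_{1})$, $(M_{2},g_{2})$ and a differentiable function $f>0$ on $M_{1}$, $M_{1}\times_{f}M_{2}$ is the product manifold $M_{1}\times M_{2}$ with the metric $g=g_{1}+f^{2}g_{2}$ (precisely $\|X\|^{2}=\|\pi_{1*}X\|^{2}+(f^{2}\circ\pi_{1})\|\pi_{2*}X\|^{2}$, where $\pi_1,\pi_2$ are the projections); $n=n_{1}+n_{2}$. $\mathcal{D}_{1}$ and $\mathcal{D}_{2}$ are the distributions on $M$ of vectors tangent to the leaves (copies of $M_{1}$) and to the fibres (copies of $M_{2}$); at $p\in M$, $T_{p}M_{1}$ and $T_{p}M_{2}$ denote the subspaces $\mathcal{D}_{1}(p)$, $\mathcal{D}_{2}(p)$ of $T_{p}M$.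 Sign of the Laplacian: $\Delta f=\sum_{j=1}^{n_{1}}\{(\nabla_{e_{j}}e_{j})f-e_{j}(e_{j}f)\}$ for a local orthonormal frame $e_{1},\dots,e_{n_{1}}$ of $M_{1}$ (so $\Delta=-\mathrm{div}\,\mathrm{grad}$). Scalar curvature of plane sections: for a $k$-dimensional subspace $\Pi_{k}\subset T_{p}M$ with orthonormal basis $e_{1},\dots,e_{k}$, $\tilde{\tau}(\Pi_{k})=\sum_{1\leq i<j\leq k}\tilde{K}(e_{i}\wedge e_{j})$, where $\tilde{K}(e_{i}\wedge e_{j})$ is the sectional curvature of the ambient manifold $\tilde{M}$ on the plane spanned by $e_{i},e_{j}$ (tangent vectors of $M$ being identified with their images in $T\tilde{M}$); $\tilde\tau(\Pi_k)=0$ if $k=1$. Submanifold notation: $\sigma$ is the second fundamental form of $x$, $H=\frac{1}{n}\sum_{i=1}^{n}\sigma(e_{i},e_{i})$ is the mean curvature vector ($e_{1},\dots,e_{n}$ an orthonormal basis of $T_{p}M$). The partial mean curvature vectors $H_{i}$ are defined by $n_{i}H_{i}=$ the trace of the restriction of $\sigma$ to $\mathcal{D}_{i}$, $i=1,2$. The immersion $x$ is mixed totally geodesic if $\sigma(X,Y)=0$ for all $X\in\mathcal{D}_{1}$, $Y\in\mathcal{D}_{2}$. *)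

(* Defs.v *)
From HB Require Import structures.
From mathcomp Require Import all_boot all_order all_algebra.
From mathcomp Require Import all_classical all_reals all_analysis.
Set Implicit Arguments.
Unset Strict Implicit.
Unset Printing Implicit Defensive.
Import Order.TTheory GRing.Theory Num.Theory.
Import numFieldNormedType.Exports.
Local Open Scope classical_set_scope.
Local Open Scope ring_scope.

(** * Calculus on open subsets of R^n

    Vectors of R^n are rows, so a linear map R^n -> R^m is a matrix in
    ['M_(n, m)] acting by right multiplication. *)

Definition partial (R : realType) (n : nat) (i : 'I_n) (h : 'rV[R]_n -> R) :
    'rV[R]_n -> R :=
  fun u => 'D_(delta_mx 0 i) h u.

Fixpoint of_class (R : realType) (n k : nat) (U : set 'rV[R]_n)
    (h : 'rV[R]_n -> R) : Prop :=
  (forall u, U u -> {for u, continuous h}) /\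
  match k with
  | 0 => True
  | k'.+1 => forall i, (forall u, U u -> derivable h u (delta_mx 0 i)) /\
                       of_class k' U (partial i h)
  end.

(** Meant for open [U]; [h] is irrelevant outside [U]. *)
Definition smooth_on (R : realType) (n : nat) (U : set 'rV[R]_n)
    (h : 'rV[R]_n -> R) : Prop :=
  forall k, of_class k U h.

Definition jac (R : realType) (n m : nat) (h : 'rV[R]_n -> 'rV[R]_m)
    (u : 'rV[R]_n) : 'M[R]_(n, m) :=
  \matrix_(i, j) partial i (fun v => h v 0 j) u.

Definition inner (R : realType) (n : nat) (G : 'M[R]_n) (X Y : 'rV[R]_n) : R :=
  (X *m G *m Y^T) 0 0.

(** * Levi-Civita connection of a metric [G] on an open subset of R^m *)

Definition christoffel (R : realType) (m : nat) (G : 'rV[R]_m -> 'M[R]_m)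
    (i j k : 'I_m) (y : 'rV[R]_m) : R :=
  2^-1 * \sum_l invmx (G y) k l *
    (partial i (fun z => G z j l) y + partial j (fun z => G z i l) y
     - partial l (fun z => G z i j) y).

(** Covariant derivative, in the direction [X] at [u], of a vector field [V]
    along the map [h]; vector fields on R^n are the case [h = id]. *)
Definition nabla (R : realType) (n m : nat) (G : 'rV[R]_m -> 'M[R]_m)
    (h : 'rV[R]_n -> 'rV[R]_m) (X : 'rV[R]_n) (V : 'rV[R]_n -> 'rV[R]_m)
    (u : 'rV[R]_n) : 'rV[R]_m :=
  \row_k ('D_X (fun v => V v 0 k) u +
          \sum_i \sum_j
             christoffel G i j k (h u) * (X *m jac h u) 0 i * V u 0 j).

(** R(X,Y)Z at [u]; the vectors are extended to fields with constant
    coordinates, so the bracket term vanishes. *)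
Definition curvature (R : realType) (n : nat) (G : 'rV[R]_n -> 'M[R]_n)
    (X Y Z : 'rV[R]_n) (u : 'rV[R]_n) : 'rV[R]_n :=
  nabla G id X (nabla G id Y (fun=> Z)) u -
  nabla G id Y (nabla G id X (fun=> Z)) u.

(** * Riemannian manifolds

    [atlas] carries the data: a topological space, charts with their inverses,
    a chosen chart around each point, and the Gram matrix of the metric in each
    chart.  The axioms are in [riemannian_manifold].  [chart] and [param] are
    meaningful only on [dom] and on its image [img].  The tangent space at [p]
    is R^n, a tangent vector being given by its coordinates in the chart
    [chart_at p]; all the pointwise notions below are computed in this chart. *)
Record atlas (R : realType) (n : nat) := Atlas {
  carrier :> topologicalType;
  chart_index : Type;
  dom : chart_index -> set carrier;
  chart : chart_index -> carrier -> 'rV[R]_n;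
  param : chart_index -> 'rV[R]_n -> carrier;
  chart_at : carrier -> chart_index;
  gram : chart_index -> 'rV[R]_n -> 'M[R]_n
}.

Section Atlas.
Context {R : realType} {n m : nat}.
Implicit Types (M : atlas R n) (N : atlas R m).

Definition img M (a : chart_index M) : set 'rV[R]_n := chart a @` dom a.

Definition loc M N (F : M -> N) (a : chart_index M) (b : chart_index N) :
    'rV[R]_n -> 'rV[R]_m :=
  fun u => chart b (F (param a u)).

Definition loc_dom M N (F : M -> N) (a : chart_index M) (b : chart_index N) :
    set 'rV[R]_n :=
  [set u | img a u /\ dom b (F (param a u))].

Definition smooth_function M (f : M -> R) : Prop :=
  forall a : chart_index M, smooth_on (img a) (f \o param a).

Definition smooth_map M N (F : M -> N) : Prop :=
  continuous F /\
  forall (a : chart_index M) (b : chart_index N) (j : 'I_m),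
    smooth_on (loc_dom F a b) (fun u => loc F a b u 0 j).

Definition coord_at M (p : M) : 'rV[R]_n := chart (chart_at p) p.

Definition gram_at M (p : M) : 'M[R]_n := gram (chart_at p) (coord_at p).

Definition differential M N (F : M -> N) (p : M) : 'M[R]_(n, m) :=
  jac (loc F (chart_at p) (chart_at (F p))) (coord_at p).

End Atlas.

Definition smooth_manifold (R : realType) (n : nat) (M : atlas R n) : Prop :=
  [/\ hausdorff_space M,
      @second_countable M,
      (forall a : chart_index M,
         [/\ open (dom a), open (img a),
             forall p, dom a p -> param a (chart a p) = p,
             forall p, dom a p -> {for p, continuous (chart a)} &
             forall u, img a u -> {for u, continuous (param a)}]),
      (forall p : M, dom (chart_at p) p) &
      (forall (a b : chart_index M) (j : 'I_n),
         smooth_on (loc_dom (@id M) a b) (fun u => loc (@id M) a b u 0 j))].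

Definition riemannian_metric (R : realType) (n : nat) (M : atlas R n) : Prop :=
  [/\ (forall (a : chart_index M) i j, smooth_on (img a) (fun u => gram a u i j)),
      (forall (a : chart_index M) u, img a u -> (gram a u)^T = gram a u),
      (forall (a : chart_index M) u (X : 'rV[R]_n), img a u -> X != 0 ->
         0 < inner (gram a u) X X) &
      (forall (a b : chart_index M) u, loc_dom (@id M) a b u ->
         let J := jac (loc (@id M) a b) u in
         gram a u = J *m gram b (loc (@id M) a b u) *m J^T)].

Definition riemannian_manifold (R : realType) (n : nat) (M : atlas R n) : Prop :=
  smooth_manifold M /\ riemannian_metric M.

Definition immersion (R : realType) (n m : nat) (M : atlas R n) (N : atlas R m)
    (x : M -> N) : Prop :=
  smooth_map x /\ forall p : M, row_free (differential x p).

Definition isometric_immersion (R : realType) (n m : nat) (M : atlas R n)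
    (N : atlas R m) (x : M -> N) : Prop :=
  immersion x /\
  forall (a : chart_index M) (b : chart_index N) u, loc_dom x a b u ->
    let J := jac (loc x a b) u in
    gram a u = J *m gram b (loc x a b u) *m J^T.

(** * Orthonormal bases and curvature

    Subspaces of the tangent space are row spaces of matrices. *)

Definition orthonormal_basis (R : realType) (n k : nat) (G : 'M[R]_n)
    (W : 'M[R]_(k, n)) (e : 'M[R]_(\rank W, n)) : Prop :=
  e *m G *m e^T = 1%:M /\ (e :=: W)%MS.

(** Some orthonormal basis (the rows of the result) of the subspace [W] of the
    tangent space at [p]; what is computed from it below does not depend on
    the choice. *)
Definition onb (R : realType) (n k : nat) (M : atlas R n) (p : M)
    (W : 'M[R]_(k, n)) : 'M[R]_(\rank W, n) :=
  xget 0 [set e | orthonormal_basis (gram_at p) e].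

Definition sectional_curvature (R : realType) (n : nat) (M : atlas R n) (p : M)
    (X Y : 'rV[R]_n) : R :=
  let g := inner (gram_at p) in
  g (curvature (gram (chart_at p)) X Y Y (coord_at p)) X /
  (g X X * g Y Y - g X Y ^+ 2).

(** A local orthonormal frame around [p]: its fields are the rows of [E]. *)
Definition local_orthonormal_frame (R : realType) (n : nat) (M : atlas R n)
    (p : M) (E : 'rV[R]_n -> 'M[R]_n) : Prop :=
  exists U : set 'rV[R]_n,
    [/\ open U, U (coord_at p), U `<=` img (chart_at p),
        forall i j, smooth_on U (fun u => E u i j) &
        forall u, U u -> E u *m gram (chart_at p) u *m (E u)^T = 1%:M].

(** Positive Laplacian [- div grad], computed in some local orthonormal frame
    [e_1, ..., e_n]: the sum of the [(nabla_(e_j) e_j) f - e_j (e_j f)]. *)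
Definition laplacian (R : realType) (n : nat) (M : atlas R n) (f : M -> R)
    (p : M) : R :=
  let G := gram (chart_at p) in
  let fl := f \o param (chart_at p) in
  let E := xget (fun=> 0) [set E | local_orthonormal_frame p E] in
  let e j u := row j (E u) in
  \sum_(j < n)
    ('D_(nabla G id (e j (coord_at p)) (e j) (coord_at p)) fl (coord_at p)
     - 'D_(e j (coord_at p)) (fun u => 'D_(e j u) fl u) (coord_at p)).

(** * Submanifolds *)

Section Submanifold.
Context {R : realType} {n m : nat} {M : atlas R n} {N : atlas R m}.
Implicit Types (x : M -> N) (p : M).

(** The Gauss formula: the connection of [N] on the field [x_* Y] along [x],
    minus the image of the connection of [M] on [Y]; [Y] is extended with
    constant coordinates, on which the difference does not depend. *)
Definition second_fundamental_form x p (X Y : 'rV[R]_n) : 'rV[R]_m :=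
  let a := chart_at p in
  let b := chart_at (x p) in
  nabla (gram b) (loc x a b) X (fun u => Y *m jac (loc x a b) u) (coord_at p)
  - nabla (gram a) id X (fun=> Y) (coord_at p) *m differential x p.

Definition sff_trace x p (k : nat) (W : 'M[R]_(k, n)) : 'rV[R]_m :=
  let e := onb p W in
  \sum_i second_fundamental_form x p (row i e) (row i e).

Definition mean_curvature x p : 'rV[R]_m :=
  n%:R^-1 *: sff_trace x p (1%:M : 'M[R]_n).

Definition ambient_tau x p (k : nat) (W : 'M[R]_(k, n)) : R :=
  let e := onb p W in
  let dx := differential x p in
  \sum_(i < \rank W) \sum_(j < \rank W | (i < j)%N)
    sectional_curvature (x p) (row i e *m dx) (row j e *m dx).

End Submanifold.

(** * Warped products *)

Definition warped_product (R : realType) (n1 n2 : nat) (M1 : atlas R n1)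
    (M2 : atlas R n2) (f : M1 -> R) : atlas R (n1 + n2) :=
  {| carrier := (M1 * M2)%type;
     chart_index := (chart_index M1 * chart_index M2)%type;
     dom := fun c => dom c.1 `*` dom c.2;
     chart := fun c p => row_mx (chart c.1 p.1) (chart c.2 p.2);
     param := fun c u => (param c.1 (lsubmx u), param c.2 (rsubmx u));
     chart_at := fun p => (chart_at p.1, chart_at p.2);
     gram := fun c u =>
       block_mx (gram c.1 (lsubmx u)) 0
                0 (f (param c.1 (lsubmx u)) ^+ 2 *: gram c.2 (rsubmx u)) |}.

(** The tangent spaces of the leaves and of the fibres, at any point. *)
Definition leaf_space (R : realType) (n1 n2 : nat) : 'M[R]_(n1, n1 + n2) :=
  row_mx 1%:M 0.

Definition fibre_space (R : realType) (n1 n2 : nat) : 'M[R]_(n2, n1 + n2) :=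
  row_mx 0 1%:M.

Section WarpedImmersion.
Context {R : realType} {n1 n2 m : nat}.
Context {M1 : atlas R n1} {M2 : atlas R n2} {f : M1 -> R} {N : atlas R m}.
Implicit Types (x : warped_product M2 f -> N) (p : warped_product M2 f).

Definition partial_mean_curvature1 x p : 'rV[R]_m :=
  n1%:R^-1 *: sff_trace x p (leaf_space R n1 n2).

Definition partial_mean_curvature2 x p : 'rV[R]_m :=
  n2%:R^-1 *: sff_trace x p (fibre_space R n1 n2).

Definition mixed_totally_geodesic x : Prop :=
  forall p (X Y : 'rV[R]_(n1 + n2)),
    (X <= leaf_space R n1 n2)%MS -> (Y <= fibre_space R n1 n2)%MS ->
    second_fundamental_form x p X Y = 0.

End WarpedImmersion.
Arguments warped_product {R n1 n2} M1 M2 f.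

(* Main.v *)
From HB Require Import structures.
Require Import Defs.
From mathcomp Require Import all_boot all_order all_algebra.
From mathcomp Require Import all_classical all_reals all_analysis.
From mathcomp Require Import ring lra.

(** In a chart, let [V_a] be the fields [x_* d_a] along the immersion, [D] the
    covariant derivative of the ambient manifold, and [<,>] its metric.
    Differentiating [<D_b V_c, V_d>], which by the Koszul formula is a
    Christoffel symbol of the induced metric, and antisymmetrizing in [a], [b]
    yields the Gauss equation ([gauss_equation]): the ambient curvature on
    tangent vectors is the curvature of the induced metric, an expression in
    its Christoffel symbols, plus terms quadratic in the second fundamental
    form [sigma].

    For a warped metric and [X] tangent to a leaf, [V] tangent to a fibre, the
    intrinsic part is [- f Hess f (X, X) g_2(V, V)]
    ([intrinsic_riemann_warped]), that is [- Hess f (X, X) |V|^2 / f].  Let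
    [e_i] and [e'_j] be orthonormal bases of the tangent spaces of the leaf and
    of the fibre.  Since [Delta f = - tr Hess f] ([laplacian_hessian]), summing
    over all pairs gives ([mixed_curvature_sum])
    [[
      sum K(e_i, e'_j) = n_2 Delta f / f - <t_1, t_2> + sum |sigma(e_i, e'_j)|^2
    ]]
    where [K] is the ambient sectional curvature and [t_1], [t_2] are the
    traces of [sigma] on the two distributions.  The left hand side is
    [tau(T_p M) - tau(T_p M_1) - tau(T_p M_2)], because the scalar curvature of
    a subspace does not depend on the orthonormal basis and the two bases
    together span the tangent space ([ambient_tau_split]).  As
    [n^2 |H|^2 = |t_1 + t_2|^2], the right hand side of the inequality exceeds
    the left one by exactly ([deficit])
    [[
      |t_1 - t_2|^2 / 4 + sum |sigma(e_i, e'_j)|^2,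
    ]]
    which is nonnegative and vanishes precisely in the stated equality case.

    Two analytic facts are needed underneath: functions with continuous
    partial derivatives are differentiable, and mixed partial derivatives of
    functions of class [C^2] commute.  Moreover the orthonormal frame in the
    Laplacian has to exist as a smooth frame; it is obtained by Gram-Schmidt,
    written as a recursion on Schur complements ([gram_schmidt]).

    Tangent vectors are rows and act from the left.  Derivatives of vector
    fields and of tensors are handled as matrices: the coordinate fields [V_b]
    are the rows of the Jacobian matrix. *)

Set Implicit Arguments.
Unset Strict Implicit.
Unset Printing Implicit Defensive.
Import Order.TTheory GRing.Theory Num.Theory.
Import numFieldNormedType.Exports.
Local Open Scope classical_set_scope.
Local Open Scope ring_scope.

(** * Differentiability from continuous partial derivatives *)

Section DirectionalDerivatives.
Context {R : realType} {V : normedModType R}.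
Implicit Types (F : V -> R) (u v : V) (t c : R).

(** Directional derivatives are derivatives on the real line, where the mean value
    theorem and the chain rule are available. *)
Lemma is_derive_line F u v t d :
  is_derive (t *: v + u) v F d <-> is_derive t 1 (fun s => F (s *: v + u)) d.
Proof.
have E : (fun h => h^-1 *: ((F \o shift (t *: v + u)) (h *: v) - F (t *: v + u))) =
    (fun h => h^-1 *: (((fun s => F (s *: v + u)) \o shift t) (h *: 1) - F (t *: v + u))).
  apply/funext => h /=; rewrite addrA -scalerDl.
  by rewrite [h *: 1]mulr1.
split=> -[dF <-]; split.
- by move: dF; rewrite /derivable E.
- by rewrite /derive E.
- by rewrite /derivable E.
- by rewrite /derive E.
Qed.

Lemma is_deriveZdir F u v c d : is_derive u v F d -> is_derive u (c *: v) F (c * d).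
Proof.
move=> dF; have : is_derive (0 *: v + u) v F d by rewrite scale0r add0r.
move=> /is_derive_line [] /derivable1_diffP gd gE.
suff : is_derive (0 *: (c *: v) + u) (c *: v) F (c * d) by rewrite scale0r add0r.
apply/is_derive_line.
have -> : (fun s => F (s *: (c *: v) + u)) = (fun s => F (s *: v + u)) \o ( *:%R c).
  by apply/funext => s /=; rewrite scalerA mulrC.
have gd' : differentiable (fun s : R => F (s *: v + u)) (c *: 0) by rewrite scaler0.
have dc : is_derive (0 : R) (1 : R) ( *:%R c) (c *: (1 : R)).
  exact: is_deriveZ.
split.
  by apply/derivable1_diffP/differentiable_comp => //; apply/derivable1_diffP; case: dc.
rewrite -derive1E derive1_comp; last 2 first.
- by case: dc.
- exact/derivable1_diffP.
rewrite !derive1E derive_val scaler0 gE [_ *: _]mulr1 mulrC //.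
Qed.

Lemma mean_value_line F u v :
  (forall t, 0 <= t <= 1 -> derivable F (t *: v + u) v) ->
  exists2 t, 0 <= t <= 1 & F (v + u) - F u = 'D_v F (t *: v + u).
Proof.
move=> dF.
pose g s := F (s *: v + u).
have dg t : 0 <= t <= 1 -> is_derive t 1 g ('D_v F (t *: v + u)).
  by move=> /dF /derivableP /is_derive_line.
have [||c cI] := @MVT_segment R g (fun t => 'D_v F (t *: v + u)) 0 1 ler01.
- move=> t; rewrite in_itv /= => /andP[t0 t1]; apply: dg.
  by rewrite !ltW.
- apply: derivable_within_continuous => t; rewrite in_itv /= => /dg.
  by case.
rewrite subr0 mulr1 /g scale1r scale0r add0r => E; exists c => //.
Qed.

End DirectionalDerivatives.

Section ContinuouslyDifferentiable.
Context {R : realType} {n : nat}.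
Implicit Types (U : set 'rV[R]_n) (F : 'rV[R]_n -> R) (u w v : 'rV[R]_n).

Lemma norm_coord_le w (i : 'I_n) : `|w 0 i| <= `|w|.
Proof.
rewrite [leRHS]/Num.Def.normr/= mx_normrE.
exact: (le_bigmax _ (fun i : 'I_1 * 'I_n => `|w i.1 i.2|) (0, i)).
Qed.

Lemma rV_norm_le w (e : R) : 0 <= e -> (forall i, `|w 0 i| <= e) -> `|w| <= e.
Proof.
move=> e0 we; rewrite [leLHS]/Num.Def.normr/= mx_normrE.
by apply: bigmax_le => // -[i j] _ /=; rewrite ord1.
Qed.

(** The corners of the path from [0] to [w] that changes one coordinate at a time. *)
Definition truncate (k : nat) w : 'rV[R]_n := \row_j (if (j < k)%N then w 0 j else 0).

Lemma truncateS (i : 'I_n) w :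
  truncate i.+1 w = w 0 i *: delta_mx 0 i + truncate i w.
Proof.
apply/rowP => j; rewrite !mxE eqxx /= ltnS leq_eqVlt (inj_eq val_inj).
have [->|ji] := eqVneq j i; last by rewrite mulr0 add0r.
by rewrite ltnn mulr1 addr0.
Qed.

(** In the sup norm the path through the corners does not leave the ball of radius
    [`|w|], so that partial derivatives along it are controlled by continuity at
    its start. *)
Lemma truncate_segment_le (i : 'I_n) w (t : R) : 0 <= t <= 1 ->
  `|t *: (w 0 i *: delta_mx 0 i) + truncate i w| <= `|w|.
Proof.
move=> /andP[t0 t1]; apply: rV_norm_le => // j; rewrite !mxE eqxx /=.
have [->|ji] := eqVneq j i.
  rewrite ltnn addr0 mulr1 normrM ger0_norm //.
  apply: le_trans (norm_coord_le w i).
  by rewrite ler_piMl.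
rewrite mulr0 mulr0 add0r; case: ifP => _; last by rewrite normr0.
exact: norm_coord_le.
Qed.

Definition gradient F u v : R := \sum_i v 0 i * partial i F u.

Lemma gradient_is_linear F u : linear (gradient F u).
Proof.
move=> c v w; rewrite /gradient scaler_sumr -big_split /=.
by apply: eq_bigr => i _; rewrite !mxE mulrDl -mulrA.
Qed.

HB.instance Definition _ F u :=
  GRing.isLinear.Build R 'rV[R]_n R _ (gradient F u) (gradient_is_linear F u).

(** The increment of [F] telescopes along the corners; by the mean value theorem
    each edge contributes a partial derivative at a point of the path, close to
    the one at [u]. *)
Lemma truncate_estimate U F u : open U -> U u -> of_class 1 U F ->
  forall e : R, 0 < e -> nbhs (0 : 'rV[R]_n)
    [set w : 'rV[R]_n | `|F (w + u) - F u - gradient F u w| <= e * `|w|].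
Proof.
move=> oU Uu [_ dF] e e0.
(* The error [e] is shared among the [n] edges; [n.+1] keeps the quotient
   meaningful for [n = 0]. *)
pose e' := e / n.+1%:R.
have e'0 : 0 < e' by rewrite divr_gt0.
have [d d0 Bd] : exists2 d : R, 0 < d & forall w, `|w| < d -> U (w + u) /\
   forall i, `|partial i F (w + u) - partial i F u| <= e'.
  have nU : nbhs u U by exact: open_nbhs_nbhs.
  have nP : \forall z \near u, forall i, `|partial i F z - partial i F u| <= e'.
    refine (@filter_forall _ _ (fun i z => `|partial i F z - partial i F u| <= e')
      (nbhs u) _ _).
    move=> i; have [_ [+ _]] := dF i.
    move=> /(_ u Uu) /cvgrPdist_le /(_ e' e'0) /= H; near=> z.
    by rewrite distrC; near: z.
  have : nbhs u (U `&` [set z | forall i, `|partial i F z - partial i F u| <= e']).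
    exact: filterI nU nP.
  move=> /nbhs_ballP[d d0 Bd]; exists d => // w wd.
  apply: Bd; by rewrite -ball_normE /= opprD addrCA subrr addr0 normrN.
apply/nbhs_ballP; exists d => //= w; rewrite -ball_normE /= sub0r normrN => wd.
have step k : (k <= n)%N ->
  `|F (truncate k w + u) - F u - gradient F u (truncate k w)| <= k%:R * (e' * `|w|).
  elim: k => [|k IH] kn.
    have -> : truncate 0 w = 0 by apply/rowP => j; rewrite !mxE.
    rewrite mul0r /gradient big1 ?add0r ?subrr ?subr0 ?normr0 // => i _.
    by rewrite mxE mul0r.
  pose i := Ordinal kn.
  have -> : truncate k.+1 w = w 0 i *: delta_mx 0 i + truncate k w := truncateS i w.
  rewrite gradient_is_linear.
  have -> : gradient F u (delta_mx 0 i) = partial i F u.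
    rewrite /gradient (bigD1 i) //= mxE !eqxx mul1r big1 ?addr0 // => j ji.
    by rewrite mxE (negbTE ji) andbF mul0r.
  have inU t : 0 <= t <= 1 -> `|t *: (w 0 i *: delta_mx 0 i) + truncate k w| < d.
    by move=> tI; apply: le_lt_trans wd; exact: (truncate_segment_le i).
  have dl t : 0 <= t <= 1 -> is_derive (t *: (w 0 i *: delta_mx 0 i) + (truncate k w + u))
      (w 0 i *: delta_mx 0 i) F
      (w 0 i * partial i F (t *: (w 0 i *: delta_mx 0 i) + (truncate k w + u))).
    move=> tI; apply: is_deriveZdir; rewrite addrA.
    have [Uz _] := Bd _ (inU t tI).
    by apply: derivableP; have [+ _] := dF i; apply.
  have [|t tI E] := @mean_value_line R _ F (truncate k w + u) (w 0 i *: delta_mx 0 i).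
    by move=> t /dl[].
  move: E; rewrite (@derive_val _ _ _ _ _ _ _ (dl t tI)) addrA => E.
  have -> : F (w 0 i *: delta_mx 0 i + truncate k w + u) - F u -
     (w 0 i *: partial i F u + gradient F u (truncate k w)) =
     w 0 i * (partial i F (t *: (w 0 i *: delta_mx 0 i) + (truncate k w + u))
              - partial i F u) +
     (F (truncate k w + u) - F u - gradient F u (truncate k w)).
    rewrite mulrBr -E -[_ *: partial _ _ _]/(_ * _); ring.
  apply: le_trans (ler_normD _ _) _.
  rewrite -natr1 mulrDl mul1r addrC; apply: lerD; first by apply: IH; exact: ltnW.
  rewrite normrM mulrC ler_pM ?normr_ge0 ?norm_coord_le //.
  by rewrite addrA; have [_] := Bd _ (inU t tI).
have := step n (leqnn n).
have -> : truncate n w = w by apply/rowP => j; rewrite !mxE ltn_ord.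
move/le_trans; apply; rewrite mulrA ler_wpM2r // /e' mulrCA -[leRHS]mulr1.
by rewrite ler_wpM2l ?(ltW e0) // ler_pdivrMr ?ltr0n // mul1r ler_nat.
Unshelve. all: by end_near. Qed.

Lemma C1_is_diff U F u : open U -> U u -> of_class 1 U F ->
  is_diff u F (gradient F u).
Proof.
move=> oU Uu CF.
pose gl : {linear 'rV[R]_n -> R} := gradient F u.
have gcont : continuous gl.
  change (continuous (fun v : 'rV[R]_n => \sum_i v 0 i * partial i F u)).
  apply: continuous_big => [|i _]; first exact: add_continuous.
  move=> v; apply: (@continuousM _ _ (fun v : 'rV[R]_n => v 0 i)).
    exact: coord_continuous.
  exact: cst_continuous.
have D : 'd F u = gl :> (_ -> _).
  apply: diff_unique => //; apply/eqaddoP => e e0.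
  near=> w; rewrite /= -![(_ + _ : _ -> _) _]/(_ + _) -![(- _ : _ -> _) _]/(- _).
  by rewrite opprD addrA; near: w; exact: (truncate_estimate oU Uu CF).
split => //; apply/diff_locallyP; rewrite D; split=> //; apply/eqaddoP => e e0.
near=> w; rewrite /= -![(_ + _ : _ -> _) _]/(_ + _) -![(- _ : _ -> _) _]/(- _).
by rewrite opprD addrA; near: w; exact: (truncate_estimate oU Uu CF).
Unshelve. all: by end_near. Qed.

End ContinuouslyDifferentiable.

(** * Symmetry of second partial derivatives *)

Section Schwarz.
Context {R : realType} {n : nat}.
Implicit Types (U : set 'rV[R]_n) (F : 'rV[R]_n -> R) (u w v : 'rV[R]_n).

Lemma is_derive_translate F a u v d :
  is_derive (a + u) v F d -> is_derive u v (fun w => F (a + w)) d.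
Proof.
have E : (fun h => h^-1 *: ((F \o shift (a + u)) (h *: v) - F (a + u))) =
    (fun h => h^-1 *: (((fun w => F (a + w)) \o shift u) (h *: v) - F (a + u))).
  by apply/funext => h /=; rewrite addrCA.
by move=> [dF <-]; split; [move: dF; rewrite /derivable E|rewrite /derive E].
Qed.

Lemma norm_delta_combination (a b : R) (i j : 'I_n) :
  `|a *: delta_mx 0 j + b *: delta_mx 0 i : 'rV[R]_n| <= `|a| + `|b|.
Proof.
apply: le_trans (ler_normD _ _) _; rewrite !normrZ.
by apply: lerD; rewrite ler_piMr //; apply: rV_norm_le => // k;
  rewrite mxE; case: (_ && _); rewrite ?normr1 ?normr0.
Qed.

(** The mean value theorem is used twice: in direction [i] for the difference
    [w |-> F (t d_j + w) - F w], and in direction [j] for the partial derivative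
    that comes out. *)
Lemma second_difference U F u i j : U u -> open U -> of_class 2 U F ->
  exists2 r : R, 0 < r & forall t, 0 < t < r -> exists2 w, `|w| <= 2 * t &
    F (t *: delta_mx 0 j + (t *: delta_mx 0 i + u)) - F (t *: delta_mx 0 i + u)
    - (F (t *: delta_mx 0 j + u) - F u)
    = t ^+ 2 * partial j (partial i F) (w + u).
Proof.
move=> Uu oU [_ CF].
have [dFi [_ CFi]] := CF i.
have [dFij _] := CFi j.
have /nbhs_ballP[r r0 rU] : nbhs u U by exact: open_nbhs_nbhs.
exists (r / 2); first by rewrite divr_gt0.
move=> t /andP[t0 tr].
have inU (a b : R) : 0 <= a <= t -> 0 <= b <= t ->
    U (a *: delta_mx 0 j + (b *: delta_mx 0 i + u)).
  move=> /andP[a0 at_] /andP[b0 bt]; apply: rU; rewrite -ball_normE /= addrA.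
  rewrite opprD addrCA subrr addr0 normrN.
  apply: le_lt_trans (norm_delta_combination _ _ _ _) _; rewrite !ger0_norm //; lra.
pose phi w := F (t *: delta_mx 0 j + w) - F w.
have dphi s : 0 <= s <= 1 ->
   is_derive (s *: (t *: delta_mx 0 i) + u) (t *: delta_mx 0 i) phi
   (t * (partial i F (t *: delta_mx 0 j + ((s * t) *: delta_mx 0 i + u)) -
     partial i F ((s * t) *: delta_mx 0 i + u))).
  move=> /andP[s0 s1]; rewrite scalerA.
  have st0 : 0 <= s * t by rewrite mulr_ge0 // ltW.
  have stt : s * t <= t by rewrite ler_piMl // ltW.
  have st : 0 <= s * t <= t by rewrite st0 stt.
  apply: is_deriveZdir; apply: is_deriveB.
    apply: is_derive_translate; apply/derivableP/dFi/inU => //.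
    by rewrite lexx ltW.
  apply/derivableP/dFi; rewrite -[_ + u]add0r -(scale0r (delta_mx 0 j)).
  by apply: inU => //; rewrite lexx ltW.
have [|s sI] := @mean_value_line R _ phi u (t *: delta_mx 0 i).
  by move=> s /dphi[].
rewrite (@derive_val _ _ _ _ _ _ _ (dphi s sI)) /phi.
have [z zE] : {z | z = (s * t) *: delta_mx 0 i + u} by eexists.
rewrite -zE; have st : 0 <= s * t <= t.
  by move/andP: sI => [s0 s1]; rewrite mulr_ge0 ?(ltW t0) //= ler_piMl // ltW.
have dpsi q : 0 <= q <= 1 -> is_derive (q *: (t *: delta_mx 0 j) + z) (t *: delta_mx 0 j)
    (partial i F) (t * partial j (partial i F) ((q * t) *: delta_mx 0 j + z)).
  move=> /andP[q0 q1]; rewrite scalerA.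
  refine (is_deriveZdir t (derivableP _)).
  apply: dFij; rewrite zE; apply: inU => //.
  by rewrite mulr_ge0 ?(ltW t0) //= ler_piMl // ltW.
have [|q qI ->] := @mean_value_line R _ (partial i F) z (t *: delta_mx 0 j).
  by move=> q /dpsi[].
rewrite (@derive_val _ _ _ _ _ _ _ (dpsi q qI)) => ->.
exists ((q * t) *: delta_mx 0 j + (s * t) *: delta_mx 0 i).
  apply: le_trans (norm_delta_combination _ _ _ _) _.
  move/andP: st => [st0 stt]; move/andP: qI => [q0 q1].
  have qt : q * t <= t by rewrite ler_piMl // ltW.
  by rewrite !ger0_norm // ?mulr_ge0 ?(ltW t0) //; lra.
by rewrite -addrA -zE mulrA expr2.
Qed.

(** The second difference is symmetric in the two directions.  Hence the two mixed
    derivatives take a common value at points arbitrarily close to [u], and they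
    agree at [u] by continuity. *)
Lemma partialC U F u i j : open U -> U u -> of_class 2 U F ->
  partial i (partial j F) u = partial j (partial i F) u.
Proof.
move=> oU Uu CF; apply/eqP; rewrite -subr_eq0; apply/negP => /negP ne.
set A := partial i _ u in ne *; set B := partial j _ u in ne *.
pose e := `|A - B| / 3.
have e0 : 0 < e by rewrite divr_gt0 // normr_gt0.
have [_ CFu] := CF.
have cont k l : exists2 d : R, 0 < d & forall w, `|w| < d ->
    `|partial k (partial l F) (w + u) - partial k (partial l F) u| <= e.
  have [_ [_ /(_ k) [_ [+ _]]]] := CFu l.
  move=> /(_ u Uu) /cvgrPdist_le /(_ e e0) /nbhs_ballP[d d0 Bd].
  exists d => // w wd; rewrite distrC; apply: Bd.
  by rewrite -ball_normE /= opprD addrCA subrr addr0 normrN.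
have [d1 d10 Bd1] := cont i j.
have [d2 d20 Bd2] := cont j i.
have [r1 r10 D1] := @second_difference U F u i j Uu oU CF.
have [r2 r20 D2] := @second_difference U F u j i Uu oU CF.
(* Intermediate points are at distance at most [2 t] from [u]. *)
pose t := Num.min (Num.min (d1 / 3) (d2 / 3)) (Num.min (r1 / 2) (r2 / 2)).
have t0 : 0 < t by rewrite !lt_min !divr_gt0.
have : t <= t by [].
rewrite {2}/t !le_min -!andbA => /and4P[td1 td2 tr1 tr2].
have lt3 (x y : R) : 0 < x -> x <= y / 3 -> 2 * x < y by clear; lra.
have lt2 (x y : R) : 0 < x -> x <= y / 2 -> x < y by clear; lra.
have [w1 w1t E1] := D1 t (introT andP (conj t0 (lt2 _ _ t0 tr1))).
have [w2 w2t E2] := D2 t (introT andP (conj t0 (lt2 _ _ t0 tr2))).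
have : t ^+ 2 * partial i (partial j F) (w2 + u) =
    t ^+ 2 * partial j (partial i F) (w1 + u).
  refine (etrans (esym E2) (etrans _ E1)).
  rewrite (_ : t *: delta_mx 0 i + (_ + _) = t *: delta_mx 0 j + (t *: delta_mx 0 i + u)).
    2: exact: addrCA.
  move: (F _) (F _) (F _) (F _); clear.
  by move=> a b c d; ring.
move/(mulfI (lt0r_neq0 (exprn_gt0 2 t0))) => E.
have := Bd1 w2 (le_lt_trans w2t (lt3 _ _ t0 td1)); rewrite E -/A => H1.
have := Bd2 w1 (le_lt_trans w1t (lt3 _ _ t0 td2)); rewrite -/B => H2.
have : `|A - B| <= e + e.
  rewrite -(subrKA (partial j (partial i F) (w1 + u))).
  apply: le_trans (ler_normD _ _) _; rewrite [X in X + _ <= _]distrC.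
  exact: lerD H1 H2.
have contra (a b : R) : 0 < a -> 3 * a = b -> b <= a + a -> False by clear; lra.
by apply: contra e0 _; rewrite /e mulrC divfK.
Qed.

End Schwarz.

(** * Operations on smooth functions *)

Section SmoothFunctions.
Context {R : realType} {n : nat}.
Implicit Types (U : set 'rV[R]_n) (h g : 'rV[R]_n -> R) (u w v : 'rV[R]_n).

Lemma of_classW k U h : of_class k.+1 U h -> of_class k U h.
Proof.
elim: k h => [|k IH] h [hc dh]; first by split.
by split=> // i; have [hi ci] := dh i; split=> //; exact: IH.
Qed.

Lemma of_class_eq k U h g : open U -> (forall u, U u -> h u = g u) ->
  of_class k U h -> of_class k U g.
Proof.
move=> oU; have near_hg h' g' u : (forall u, U u -> h' u = g' u) -> U u ->
    \forall w \near u, h' w = g' w.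
  move=> hg Uu; have nU : nbhs u U by exact: open_nbhs_nbhs.
  by near=> w; apply: hg; near: w.
have cont h' g' : (forall u, U u -> h' u = g' u) ->
    (forall u, U u -> {for u, continuous h'}) ->
    forall u, U u -> {for u, continuous g'}.
  move=> hg hc u Uu; rewrite /prop_for /continuous_at -(hg u Uu).
  apply: cvg_trans (hc u Uu).
  exact: (@near_eq_cvg _ _ (nbhs u) _ _ _ (near_hg _ _ u hg Uu)).
elim: k h g => [|k IH] h g hg [hc dh]; split=> //; try exact: cont hg hc.
move=> i; have [hi ci] := dh i; split.
  move=> u Uu; apply: near_eq_derivable (hi u Uu); exact: (near_hg _ _ u hg Uu).
apply: IH ci => u Uu; apply: near_eq_derive; exact: (near_hg _ _ u hg Uu).
Unshelve. all: by end_near. Qed.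

Lemma of_class_cst k U (c : R) : of_class k U (fun=> c).
Proof.
elim: k c => [|k IH] c; split=> //; try by move=> u _; exact: cst_continuous.
move=> i; split; first by move=> u _; exact: derivable_cst.
have -> : partial i (fun=> c) = (fun=> 0) :> ('rV[R]_n -> R).
  by apply/funext => u; exact: derive_cst.
exact: IH.
Qed.

Lemma of_classD k U h g : open U -> of_class k U h -> of_class k U g ->
  of_class k U (fun u => h u + g u).
Proof.
move=> oU.
have cont h' g' : (forall u, U u -> {for u, continuous h'}) ->
    (forall u, U u -> {for u, continuous g'}) ->
    forall u, U u -> {for u, continuous (fun u => h' u + g' u)}.
  by move=> hc gc u Uu; apply: continuousD; [exact: hc|exact: gc].
elim: k h g => [|k IH] h g [hc dh] [gc dg]; split; try exact: cont; first exact: I.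
move=> i; have [hi hci] := dh i; have [gi gci] := dg i; split.
  by move=> u Uu; exact: derivableD (hi u Uu) (gi u Uu).
apply: of_class_eq oU _ (IH _ _ hci gci) => u Uu.
exact/esym/(deriveD (hi u Uu) (gi u Uu)).
Qed.

Lemma of_classM k U h g : open U -> of_class k U h -> of_class k U g ->
  of_class k U (fun u => h u * g u).
Proof.
move=> oU; have cont h' g' : (forall u, U u -> {for u, continuous h'}) ->
    (forall u, U u -> {for u, continuous g'}) ->
    forall u, U u -> {for u, continuous (fun u => h' u * g' u)}.
  by move=> hc gc u Uu; apply: continuousM; [exact: hc|exact: gc].
elim: k h g => [|k IH] h g Ch Cg; case: (Ch) => hc dh; case: (Cg) => gc dg;
  split; try exact: cont; first exact: I.
move=> i; have [hi hci] := dh i; have [gi gci] := dg i; split.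
  by move=> u Uu; exact: derivableM (hi u Uu) (gi u Uu).
have Ch' := of_classW Ch; have Cg' := of_classW Cg.
apply: of_class_eq oU _ (of_classD oU (IH _ _ Ch' gci) (IH _ _ Cg' hci)) => u Uu.
exact/esym/(deriveM (hi u Uu) (gi u Uu)).
Qed.

Lemma is_derive_rsqrt h u v d : 0 < h u -> is_derive u v h d ->
  is_derive u v (fun w => (Num.sqrt (h w))^-1)
    (- 2^-1 * d * (Num.sqrt (h u))^-1 ^+ 3).
Proof.
move=> hu dh.
have u0 : 0 *: v + u = u by rewrite scale0r add0r.
have dh0 : is_derive (0 : R) 1 (fun s => h (s *: v + u)) d.
  by apply: (iffLR (@is_derive_line R _ h u v 0 d)); rewrite u0.
have h0 : 0 < h (0 *: v + u) by rewrite u0.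
have dsq := @is_derive1_comp R Num.sqrt _ 0 _ _ (is_derive1_sqrt h0) dh0.
have sq0 : Num.sqrt (h (0 *: v + u)) != 0 by rewrite gt_eqF // sqrtr_gt0.
have dV := @is_deriveV R (fun s => Num.sqrt (h (s *: v + u))) 0 _ 1 sq0 dsq.
have {dV} := iffRL (@is_derive_line R _ (fun w => (Num.sqrt (h w))^-1) u v 0 _) dV.
rewrite u0 => dV; apply: (is_derive_eq dV).
rewrite /= u0 in sq0 *; rewrite -[_ *: _]/(_ * _).
by move: (Num.sqrt _) sq0 => q q0; field.
Qed.

(** The induction closes because the derivative of [r = h^(-1/2)] is the polynomial
    [- h' r^3 / 2] in [h'] and [r]. *)
Lemma of_class_rsqrt k U h : open U -> (forall u, U u -> 0 < h u) ->
  of_class k U h -> of_class k U (fun u => (Num.sqrt (h u))^-1).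
Proof.
move=> oU h0.
have cont : (forall u, U u -> {for u, continuous h}) ->
    forall u, U u -> {for u, continuous (fun u => (Num.sqrt (h u))^-1)}.
  move=> hc u Uu; apply: continuousV; first by rewrite gt_eqF // sqrtr_gt0 h0.
  apply: (@continuous_comp _ _ _ h Num.sqrt); first exact: hc.
  exact: sqrt_continuous.
elim: k => [|k IH] Ch; first by case: Ch => hc _; split; [exact: cont|].
case: (Ch) => hc dh; split; first exact: cont.
have Cr := IH (of_classW Ch).
have dr i u : U u -> is_derive u (delta_mx 0 i) (fun u => (Num.sqrt (h u))^-1)
    (- 2^-1 * partial i h u * (Num.sqrt (h u))^-1 ^+ 3).
  move=> Uu; apply: is_derive_rsqrt (h0 u Uu) _.
  by apply/derivableP; have [+ _] := dh i; apply.
move=> i; split; first by move=> u /(dr i)[].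
have [_ ci] := dh i.
have M := of_classM oU.
apply: of_class_eq oU _ (M k _ _ (M k _ _ (of_class_cst k U (- 2^-1)) ci)
  (M k _ _ Cr (M k _ _ Cr Cr))) => u Uu.
exact/esym/(@derive_val _ _ _ _ _ _ _ (dr i u Uu)).
Qed.

End SmoothFunctions.

(** * Derivatives of matrix-valued functions *)

Section ChainRule.
Context {R : realType} {n m : nat}.

(** The inner function is only assumed to have a derivative in the direction [v];
    the chain rule is therefore applied to the curve [s |-> h (s v + u)]. *)
Lemma is_derive_comp (O : set 'rV[R]_m) (F : 'rV[R]_m -> R)
    (h : 'rV[R]_n -> 'rV[R]_m) (u v : 'rV[R]_n) (dh : 'rV[R]_m) :
  open O -> of_class 1 O F -> O (h u) ->
  (forall j, is_derive u v (fun w => h w 0 j) (dh 0 j)) ->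
  is_derive u v (fun w => F (h w)) (gradient F (h u) dh).
Proof.
move=> oO CF Ohu dhj.
have u0 : 0 *: v + u = u by rewrite scale0r add0r.
pose c (s : R) := h (s *: v + u).
have dc j : is_derive (0 : R) 1 (fun s => c s 0 j) (dh 0 j).
  by apply: (iffLR (@is_derive_line R _ (fun w => h w 0 j) u v 0 (dh 0 j))); rewrite u0.
have c_der : derivable c 0 1.
  by apply/derivable_mxP => i j; rewrite ord1; case: (dc j).
have c_diff : differentiable c 0 by exact/derivable1_diffP.
have [F_diff F_grad] : is_diff (c 0) F (gradient F (c 0)).
  by apply: C1_is_diff oO _ CF; rewrite /c u0.
have Dc : 'D_1 c 0 = dh.
  rewrite derive_mx //; apply/rowP => j; rewrite !mxE.
  exact: (@derive_val _ _ _ _ _ _ _ (dc j)).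
have comp_diff : differentiable (F \o c) 0 by exact: differentiable_comp.
suff comp_der : is_derive (0 : R) 1 (F \o c) (gradient F (c 0) dh).
  have := iffRL (@is_derive_line R _ (fun w => F (h w)) u v 0 _) comp_der.
  by rewrite /c u0.
split; first exact/derivable1_diffP.
rewrite deriveE // diff_comp //= F_grad; congr (gradient F _ _).
by rewrite -deriveE.
Qed.

End ChainRule.

(** Entrywise, so that it makes sense without any differentiability; sealed, because
    two partial derivatives should never be compared by unfolding limits. *)
HB.lock Definition mpartial (R : realType) (n p q : nat) (a : 'I_n)
    (F : 'rV[R]_n -> 'M[R]_(p, q)) (u : 'rV[R]_n) : 'M[R]_(p, q) :=
  \matrix_(i, j) partial a (fun w => F w i j) u.

Section MatrixDerivatives.
Context {R : realType} {n : nat}.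
Implicit Types (U : set 'rV[R]_n) (u v : 'rV[R]_n).

Definition is_mderive p q u v (F : 'rV[R]_n -> 'M[R]_(p, q)) (dF : 'M[R]_(p, q)) :=
  forall i j, is_derive u v (fun w => F w i j) (dF i j).

Definition smooth_mx p q U (F : 'rV[R]_n -> 'M[R]_(p, q)) :=
  forall i j, smooth_on U (fun w => F w i j).

Lemma mpartialE p q a (F : 'rV[R]_n -> 'M[R]_(p, q)) u i j :
  mpartial a F u i j = partial a (fun w => F w i j) u.
Proof. by rewrite mpartial.unlock mxE. Qed.

Lemma mpartial_val p q (F : 'rV[R]_n -> 'M[R]_(p, q)) u a dF :
  is_mderive u (delta_mx 0 a) F dF -> mpartial a F u = dF.
Proof.
move=> dF'; apply/matrixP => i j; rewrite mpartialE.
exact: (@derive_val _ _ _ _ _ _ _ (dF' i j)).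
Qed.

Lemma is_mderive_cst p q u v (C : 'M[R]_(p, q)) : is_mderive u v (fun=> C) 0.
Proof. by move=> i j; rewrite mxE; exact: is_derive_cst. Qed.

Lemma is_mderive_eq p q U u v (F G : 'rV[R]_n -> 'M[R]_(p, q)) dF :
  open U -> U u -> (forall w, U w -> F w = G w) ->
  is_mderive u v F dF -> is_mderive u v G dF.
Proof.
move=> oU Uu FG dF' i j; apply: near_eq_is_derive (dF' i j).
have nU : nbhs u U by exact: open_nbhs_nbhs.
by near=> w; rewrite FG //; near: w.
Unshelve. all: by end_near. Qed.

Lemma is_mderiveD p q u v (F G : 'rV[R]_n -> 'M[R]_(p, q)) dF dG :
  is_mderive u v F dF -> is_mderive u v G dG ->
  is_mderive u v (fun w => F w + G w) (dF + dG).
Proof.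
move=> dF' dG' i j; rewrite mxE.
rewrite (_ : (fun w => _) = (fun w => F w i j) + (fun w => G w i j)).
  exact: is_deriveD (dF' i j) (dG' i j).
by apply/funext => w; rewrite mxE.
Qed.

Lemma is_derive_sum_seq (I : Type) (r : seq I) u v (h : I -> 'rV[R]_n -> R)
    (dh : I -> R) :
  (forall i, is_derive u v (h i) (dh i)) ->
  is_derive u v (fun w => \sum_(i <- r) h i w) (\sum_(i <- r) dh i).
Proof.
move=> dhi; elim: r => [|i r IH].
  rewrite big_nil (_ : (fun w => _) = fun=> 0); first exact: is_derive_cst.
  by apply/funext => w; rewrite big_nil.
rewrite big_cons (_ : (fun w => _) = h i + (fun w => \sum_(i <- r) h i w)).
  exact: is_deriveD (dhi i) IH.
by apply/funext => w; rewrite big_cons.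
Qed.

Lemma is_derive_mul u v (f g : 'rV[R]_n -> R) df dg :
  is_derive u v f df -> is_derive u v g dg ->
  is_derive u v (fun w => f w * g w) (df * g u + f u * dg).
Proof.
move=> df' dg'; apply: (is_derive_eq (is_deriveM df' dg')).
by rewrite addrC; congr (_ + _); exact: mulrC.
Qed.

Lemma is_mderiveM p q r u v (F : 'rV[R]_n -> 'M[R]_(p, q)) (G : 'rV[R]_n -> 'M[R]_(q, r))
    dF dG :
  is_mderive u v F dF -> is_mderive u v G dG ->
  is_mderive u v (fun w => F w *m G w) (dF *m G u + F u *m dG).
Proof.
move=> dF' dG' i j; rewrite !mxE -big_split /=.
rewrite (_ : (fun w => _) = (fun w => \sum_k F w i k * G w k j)).
  apply: is_derive_sum_seq => k.
  exact: is_derive_mul (dF' i k) (dG' k j).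
by apply/funext => w; rewrite !mxE.
Qed.

Lemma is_mderiveT p q u v (F : 'rV[R]_n -> 'M[R]_(p, q)) dF :
  is_mderive u v F dF -> is_mderive u v (fun w => (F w)^T) dF^T.
Proof.
move=> dF' i j; rewrite mxE (_ : (fun w => _) = (fun w => F w j i)); first exact: dF'.
by apply/funext => w; rewrite mxE.
Qed.

Lemma is_mderive_scale p q u v (f : 'rV[R]_n -> R) (F : 'rV[R]_n -> 'M[R]_(p, q)) df dF :
  is_derive u v f df -> is_mderive u v F dF ->
  is_mderive u v (fun w => f w *: F w) (df *: F u + f u *: dF).
Proof.
move=> df' dF' i j; rewrite !mxE (_ : (fun w => _) = (fun w => f w * F w i j)).
  exact: is_derive_mul df' (dF' i j).
by apply/funext => w; rewrite mxE.
Qed.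

Lemma is_mderive_sum (I : finType) p q u v (F : I -> 'rV[R]_n -> 'M[R]_(p, q)) dF :
  (forall k, is_mderive u v (F k) (dF k)) ->
  is_mderive u v (fun w => \sum_k F k w) (\sum_k dF k).
Proof.
move=> dF' i j; rewrite summxE (_ : (fun w => _) = (fun w => \sum_k F k w i j)).
  by apply: is_derive_sum_seq => k; exact: dF'.
by apply/funext => w; rewrite summxE.
Qed.

Lemma smooth_mx_is_mderive p q U (F : 'rV[R]_n -> 'M[R]_(p, q)) u v :
  open U -> U u -> smooth_mx U F ->
  is_mderive u v F (\sum_a v 0 a *: mpartial a F u).
Proof.
move=> oU Uu SF i j.
have [F_diff F_grad] := C1_is_diff oU Uu (SF i j 1%N).
split; first exact: diff_derivable.
rewrite deriveE // F_grad /gradient summxE.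
by apply: eq_bigr => a _; rewrite mxE mpartialE.
Qed.

Lemma sum_delta p q (a : 'I_n) (C : 'I_n -> 'M[R]_(p, q)) :
  \sum_b (delta_mx 0 a : 'rV[R]_n) 0 b *: C b = C a.
Proof.
rewrite (bigD1 a) //= mxE !eqxx scale1r big1 ?addr0 // => b ba.
by rewrite mxE (negbTE ba) scale0r.
Qed.

Lemma smooth_mx_partial p q U (F : 'rV[R]_n -> 'M[R]_(p, q)) u a :
  open U -> U u -> smooth_mx U F -> is_mderive u (delta_mx 0 a) F (mpartial a F u).
Proof.
move=> oU Uu SF; have := smooth_mx_is_mderive (delta_mx 0 a) oU Uu SF.
by rewrite sum_delta.
Qed.

Lemma mpartialC p q U (F : 'rV[R]_n -> 'M[R]_(p, q)) u a b :
  open U -> U u -> smooth_mx U F ->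
  mpartial a (mpartial b F) u = mpartial b (mpartial a F) u.
Proof.
move=> oU Uu SF; apply/matrixP => i j; rewrite 2!mpartialE.
have E c : (fun w => mpartial c F w i j) = partial c (fun w => F w i j).
  by apply/funext => w; rewrite mpartialE.
by rewrite 2!E; exact: partialC oU Uu (SF i j 2%N).
Qed.

Lemma smooth_on_eq U h g : open U -> (forall u, U u -> h u = g u) ->
  smooth_on U h -> smooth_on U (g : 'rV[R]_n -> R).
Proof. by move=> oU hg Sh k; exact: of_class_eq oU hg (Sh k). Qed.

Lemma smooth_mx_eq p q U (F G : 'rV[R]_n -> 'M[R]_(p, q)) :
  open U -> (forall w, U w -> F w = G w) -> smooth_mx U F -> smooth_mx U G.
Proof. by move=> oU FG SF i j; apply: smooth_on_eq oU _ (SF i j) => w Uw; rewrite FG. Qed.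

Lemma smooth_mx_mpartial p q U (F : 'rV[R]_n -> 'M[R]_(p, q)) a :
  open U -> smooth_mx U F -> smooth_mx U (mpartial a F).
Proof.
move=> oU SF i j k; have [_ /(_ a)[_ +]] := SF i j k.+1.
by apply: of_class_eq oU _ => u Uu; rewrite mpartialE.
Qed.

Lemma smooth_on_sum (I : Type) (r : seq I) U (h : I -> 'rV[R]_n -> R) :
  open U -> (forall i, smooth_on U (h i)) -> smooth_on U (fun w => \sum_(i <- r) h i w).
Proof.
move=> oU Sh k; elim: r => [|i r IH].
  rewrite (_ : (fun w => _) = fun=> 0); first exact: of_class_cst.
  by apply/funext => w; rewrite big_nil.
rewrite (_ : (fun w => _) = (fun w => h i w + \sum_(i <- r) h i w)).
  by apply: of_classD oU _ IH; exact: Sh.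
by apply/funext => w; rewrite big_cons.
Qed.

Lemma smooth_mx_cst p q U (C : 'M[R]_(p, q)) : smooth_mx U (fun=> C).
Proof. by move=> i j k; exact: of_class_cst. Qed.

Lemma smooth_mxD p q U (F G : 'rV[R]_n -> 'M[R]_(p, q)) : open U ->
  smooth_mx U F -> smooth_mx U G -> smooth_mx U (fun w => F w + G w).
Proof.
move=> oU SF SG i j k.
rewrite (_ : (fun w => _) = (fun w => F w i j + G w i j)).
  by apply: of_classD oU _ _; [exact: SF|exact: SG].
by apply/funext => w; rewrite mxE.
Qed.

Lemma smooth_mxM p q r U (F : 'rV[R]_n -> 'M[R]_(p, q)) (G : 'rV[R]_n -> 'M[R]_(q, r)) :
  open U -> smooth_mx U F -> smooth_mx U G -> smooth_mx U (fun w => F w *m G w).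
Proof.
move=> oU SF SG i j.
rewrite (_ : (fun w => _) = (fun w => \sum_k F w i k * G w k j)).
  apply: smooth_on_sum => // l k.
  by apply: of_classM oU _ _; [exact: SF|exact: SG].
by apply/funext => w; rewrite mxE.
Qed.

Lemma smooth_mx_scale p q U (f : 'rV[R]_n -> R) (F : 'rV[R]_n -> 'M[R]_(p, q)) :
  open U -> smooth_on U f -> smooth_mx U F -> smooth_mx U (fun w => f w *: F w).
Proof.
move=> oU Sf SF i j k.
rewrite (_ : (fun w => _) = (fun w => f w * F w i j)).
  by apply: of_classM oU _ _; [exact: Sf|exact: SF].
by apply/funext => w; rewrite mxE.
Qed.

Lemma smooth_mxT p q U (F : 'rV[R]_n -> 'M[R]_(p, q)) :
  smooth_mx U F -> smooth_mx U (fun w => (F w)^T).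
Proof.
move=> SF i j k; rewrite (_ : (fun w => _) = (fun w => F w j i)); first exact: SF.
by apply/funext => w; rewrite mxE.
Qed.

End MatrixDerivatives.

Lemma is_mderive_comp (R : realType) (n m p q : nat) (O : set 'rV[R]_m)
    (F : 'rV[R]_m -> 'M[R]_(p, q)) (h : 'rV[R]_n -> 'rV[R]_m)
    (u v : 'rV[R]_n) (dh : 'rV[R]_m) :
  open O -> smooth_mx O F -> O (h u) -> is_mderive u v h dh ->
  is_mderive u v (fun w => F (h w)) (\sum_k dh 0 k *: mpartial k F (h u)).
Proof.
move=> oO SF Ohu dh' i j; rewrite summxE.
apply: (is_derive_eq (is_derive_comp oO (SF i j 1%N) Ohu (dh' 0))).
by apply: eq_bigr => k _; rewrite mxE mpartialE.
Qed.

(** * Positive definite matrices and orthonormal frames *)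

Section PositiveDefinite.
Context {R : realType}.

Lemma entry_tr11 (A : 'M[R]_1) : A 0 0 = A^T 0 0.
Proof. by rewrite mxE. Qed.

Definition posdef n (G : 'M[R]_n) :=
  G^T = G /\ forall X : 'rV[R]_n, X != 0 -> 0 < inner G X X.

Lemma posdef_unit n (G : 'M[R]_n) : posdef G -> G \in unitmx.
Proof.
move=> [_ G0]; rewrite -row_free_unit; apply/row_freeP.
apply/row_freeP; rewrite -kermx_eq0; apply/eqP/row_matrixP => i; rewrite row0.
apply/eqP/negPn/negP => /G0; rewrite /inner.
have -> : row i (kermx G) *m G = 0 by apply/sub_kermxP/row_sub.
by rewrite mul0mx mxE ltxx.
Qed.

Lemma posdef_ge0 n (G : 'M[R]_n) X : posdef G -> 0 <= inner G X X.
Proof.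
move=> [_ G0]; have [->|/G0/ltW //] := eqVneq X 0.
by rewrite /inner !mul0mx mxE.
Qed.

Lemma posdef_eq0 n (G : 'M[R]_n) X : posdef G -> inner G X X = 0 -> X = 0.
Proof.
move=> [_ G0] GX; apply/eqP/negPn/negP => /G0.
by rewrite GX ltxx.
Qed.

Lemma innerC n (G : 'M[R]_n) X Y : G^T = G -> inner G X Y = inner G Y X.
Proof. by move=> sG; rewrite /inner entry_tr11 !trmx_mul trmxK sG mulmxA. Qed.

Lemma innerDl n (G : 'M[R]_n) X Y Z : inner G (X + Y) Z = inner G X Z + inner G Y Z.
Proof. by rewrite /inner !mulmxDl mxE. Qed.

Lemma innerDr n (G : 'M[R]_n) X Y Z : inner G Z (X + Y) = inner G Z X + inner G Z Y.
Proof. by rewrite /inner linearD mulmxDr mxE. Qed.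

Lemma innerZl n (G : 'M[R]_n) c X Z : inner G (c *: X) Z = c * inner G X Z.
Proof. by rewrite /inner -!scalemxAl mxE. Qed.

Lemma innerZr n (G : 'M[R]_n) c X Z : inner G Z (c *: X) = c * inner G Z X.
Proof. by rewrite /inner linearZ -scalemxAr mxE. Qed.

Lemma inner_suml n (G : 'M[R]_n) (I : finType) (X : I -> 'rV[R]_n) Z :
  inner G (\sum_i X i) Z = \sum_i inner G (X i) Z.
Proof. by rewrite /inner !mulmx_suml summxE. Qed.

Lemma inner_pullback n m (G : 'M[R]_m) (J : 'M[R]_(n, m)) X Y :
  inner (J *m G *m J^T) X Y = inner G (X *m J) (Y *m J).
Proof. by rewrite /inner trmx_mul !mulmxA. Qed.

Lemma posdef_pullback n m (G : 'M[R]_m) (J : 'M[R]_(n, m)) :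
  posdef G -> row_free J -> posdef (J *m G *m J^T).
Proof.
move=> [sG G0] fJ; split; first by rewrite !trmx_mul sG trmxK mulmxA.
move=> X X0; rewrite inner_pullback; apply: G0.
apply: contraNneq X0 => XJ; apply/eqP; apply: (row_free_inj fJ).
by rewrite XJ mul0mx.
Qed.

(** The rows are the Gram-Schmidt basis for the scalar product [G], computed through
    the Schur complement of the upper left entry.  Only polynomials and inverse
    square roots of positive entries occur, hence smooth dependence on [G]. *)
Fixpoint gram_schmidt n : 'M[R]_n -> 'M[R]_n :=
  match n with
  | 0 => fun=> 1%:M
  | n'.+1 => fun G : 'M[R]_(1 + n') =>
      let r := (Num.sqrt (G 0 0))^-1 in
      let b : 'M[R]_(1, n') := ursubmx G in
      let E := gram_schmidt (drsubmx G - (r * r) *: (b^T *m b)) in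
      block_mx r%:M 0 (- (r * r) *: (E *m b^T)) E : 'M[R]_(1 + n')
  end.

Lemma posdef_diag n (G : 'M[R]_n) i : posdef G -> 0 < G i i.
Proof.
move=> [_ /(_ (delta_mx 0 i))]; rewrite /inner -rowE trmx_delta -colE !mxE; apply.
by apply/eqP => /rowP /(_ i); rewrite !mxE !eqxx => /eqP; rewrite oner_eq0.
Qed.

Lemma posdef_block n (G : 'M[R]_(1 + n)) : posdef G ->
  G = block_mx (G 0 0)%:M (ursubmx G) (ursubmx G)^T (drsubmx G).
Proof.
move=> [sG _]; rewrite -{1}(submxK G); congr block_mx.
  by apply/matrixP => i j; rewrite !ord1 !mxE eqxx; congr (G _ _); apply/val_inj.
by rewrite -{1}sG -{1}(submxK G) tr_block_mx block_mxKdl.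
Qed.

(** The rows of [X] are orthogonal to the first basis vector, and on such vectors the
    scalar product is given by the Schur complement. *)
Lemma schur_inner n (g r : R) (b : 'M[R]_(1, n)) (C : 'M[R]_n) p (E : 'M[R]_(p, n)) :
  r * r * g = 1 ->
  let X := row_mx (- (r * r) *: (E *m b^T)) E in
  X *m block_mx g%:M b b^T C *m X^T = E *m (C - (r * r) *: (b^T *m b)) *m E^T /\
  r *: row_mx g%:M b *m X^T = 0.
Proof.
move=> rg X.
have XG : X *m block_mx g%:M b b^T C = row_mx 0 (E *m (C - (r * r) *: (b^T *m b))).
  rewrite mul_row_block; congr row_mx.
    rewrite mul_mx_scalar scalerA mulrN (mulrC g) rg scaleN1r addNr //.
  by rewrite mulmxBr addrC -scalemxAl -scalemxAr scaleNr mulmxA.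
split; first by rewrite XG tr_row_mx mul_row_col mul0mx add0r.
rewrite -scalemxAl tr_row_mx mul_row_col linearZ /= trmx_mul trmxK mul_scalar_mx scalerA.
by rewrite mulrN (mulrC g) rg scaleN1r addNr scaler0.
Qed.

Lemma schur_orthonormal n (g r : R) (b : 'M[R]_(1, n)) (C E : 'M[R]_n) :
  r * r * g = 1 -> C^T = C -> E *m (C - (r * r) *: (b^T *m b)) *m E^T = 1%:M ->
  let F := block_mx r%:M 0 (- (r * r) *: (E *m b^T)) E in
  F *m block_mx g%:M b b^T C *m F^T = 1%:M.
Proof.
move=> rg sC EC; set X := row_mx (- (r * r) *: (E *m b^T)) E.
rewrite /= -[block_mx r%:M _ _ _]/(col_mx (row_mx r%:M 0) X).
have [H1 H2] := schur_inner b C E rg; rewrite -/X EC in H1 H2.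
set B := block_mx g%:M b b^T C in H1 *.
have E1 : row_mx r%:M 0 *m B = r *: row_mx g%:M b.
  by rewrite mul_row_block !mul0mx !addr0 !mul_scalar_mx scale_row_mx.
have sB : B^T = B by rewrite tr_block_mx tr_scalar_mx trmxK sC.
have H3 : X *m B *m (row_mx r%:M 0)^T = 0.
  by apply: trmx_inj; rewrite trmx0 !trmx_mul trmxK sB mulmxA E1.
rewrite mul_col_mx tr_col_mx mul_col_row H1 H3 E1 H2.
rewrite -scalemxAl tr_row_mx mul_row_col trmx0 mulmx0 addr0 tr_scalar_mx -scalar_mxM.
by rewrite scale_scalar_mx mulrA mulrAC rg -scalar_mx_block.
Qed.

Lemma rsqrt_sq (g : R) : 0 < g -> (Num.sqrt g)^-1 * (Num.sqrt g)^-1 * g = 1.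
Proof.
move=> g0; rewrite -invfM -expr2 sqr_sqrtr ?ltW // mulVf //.
by rewrite gt_eqF.
Qed.

Lemma posdef_drsubmx n (G : 'M[R]_(1 + n)) : posdef G -> (drsubmx G)^T = drsubmx G.
Proof.
by move=> [sG _]; rewrite -[in RHS]sG -[in RHS](submxK G) tr_block_mx block_mxKdr.
Qed.

Lemma posdef_schur n (G : 'M[R]_(1 + n)) : posdef G ->
  posdef (drsubmx G - ((Num.sqrt (G 0 0))^-1 * (Num.sqrt (G 0 0))^-1) *:
    ((ursubmx G)^T *m ursubmx G)).
Proof.
move=> pG; have [sG G0] := pG; have rg := rsqrt_sq (posdef_diag 0 pG).
set r := _^-1 in rg *; set b := ursubmx G; split.
  by rewrite linearB linearZ /= trmx_mul trmxK posdef_drsubmx.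
move=> Y Y0.
have [E _] := schur_inner b (drsubmx G) Y rg.
rewrite /inner -E -posdef_block //; apply: G0.
apply: contraNneq Y0 => X0; apply/eqP.
by rewrite -(row_mxKr (- (r * r) *: (Y *m b^T)) Y) X0 linear0.
Qed.

Lemma gram_schmidtP n (G : 'M[R]_n) : posdef G ->
  gram_schmidt G *m G *m (gram_schmidt G)^T = 1%:M.
Proof.
elim: n G => [|n IH] G pG; first by apply/matrixP => -[].
have := schur_orthonormal (rsqrt_sq (posdef_diag 0 pG)) (posdef_drsubmx pG)
  (IH _ (posdef_schur pG)).
by rewrite -posdef_block.
Qed.

End PositiveDefinite.

Section SmoothFrames.
Context {R : realType} {d : nat}.
Implicit Types (U : set 'rV[R]_d).

Lemma smooth_row_mx p q1 q2 U (A : 'rV[R]_d -> 'M[R]_(p, q1))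
    (B : 'rV[R]_d -> 'M[R]_(p, q2)) :
  smooth_mx U A -> smooth_mx U B -> smooth_mx U (fun w => row_mx (A w) (B w)).
Proof.
move=> SA SB i j; case: (split_ordP j) => k ->.
  rewrite (_ : (fun w => _) = (fun w => A w i k)); first exact: SA.
  by apply/funext => w; rewrite row_mxEl.
rewrite (_ : (fun w => _) = (fun w => B w i k)); first exact: SB.
by apply/funext => w; rewrite row_mxEr.
Qed.

Lemma smooth_col_mx p1 p2 q U (A : 'rV[R]_d -> 'M[R]_(p1, q))
    (B : 'rV[R]_d -> 'M[R]_(p2, q)) :
  smooth_mx U A -> smooth_mx U B -> smooth_mx U (fun w => col_mx (A w) (B w)).
Proof.
move=> SA SB i j; case: (split_ordP i) => k ->.
  rewrite (_ : (fun w => _) = (fun w => A w k j)); first exact: SA.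
  by apply/funext => w; rewrite col_mxEu.
rewrite (_ : (fun w => _) = (fun w => B w k j)); first exact: SB.
by apply/funext => w; rewrite col_mxEd.
Qed.

Lemma smooth_gram_schmidt n U (G : 'rV[R]_d -> 'M[R]_n) :
  open U -> (forall u, U u -> posdef (G u)) -> smooth_mx U G ->
  smooth_mx U (fun u => gram_schmidt (G u)).
Proof.
move=> oU; elim: n G => [|n IH] G pG SG; first by case.
have Sr : smooth_on U (fun u => (Num.sqrt (G u 0 0))^-1).
  move=> k; apply: of_class_rsqrt => //; last exact: SG.
  by move=> u Uu; apply: posdef_diag (pG u Uu).
have Srr : smooth_on U (fun u => (Num.sqrt (G u 0 0))^-1 * (Num.sqrt (G u 0 0))^-1).
  by move=> k; apply: of_classM oU _ _; exact: Sr.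
have SNrr : smooth_on U (fun u => - ((Num.sqrt (G u 0 0))^-1 * (Num.sqrt (G u 0 0))^-1)).
  move=> k; rewrite (_ : (fun u => _) = (fun u => (-1) *
      ((Num.sqrt (G u 0 0))^-1 * (Num.sqrt (G u 0 0))^-1))).
    apply: of_classM oU _ _; [exact: of_class_cst|exact: Srr].
  by apply/funext => u; rewrite mulN1r.
have Sb : smooth_mx U (fun u => @ursubmx R 1 n 1 n (G u)).
  move=> i j; rewrite (_ : (fun w => _) = (fun w => G w (lshift n i) (rshift 1 j))).
    exact: SG.
  by apply/funext => w; rewrite !mxE.
have SC : smooth_mx U (fun u => @drsubmx R 1 n 1 n (G u)).
  move=> i j; rewrite (_ : (fun w => _) = (fun w => G w (rshift 1 i) (rshift 1 j))).
    exact: SG.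
  by apply/funext => w; rewrite !mxE.
pose r u := (Num.sqrt (G u 0 0))^-1.
pose b u := @ursubmx R 1 n 1 n (G u).
pose S u := @drsubmx R 1 n 1 n (G u) - (r u * r u) *: ((b u)^T *m b u).
have SS : smooth_mx U S.
  rewrite (_ : S = fun u => @drsubmx R 1 n 1 n (G u)
                            + (- (r u * r u)) *: ((b u)^T *m b u)).
    apply: (smooth_mxD oU SC); apply: (smooth_mx_scale oU SNrr).
    exact: smooth_mxM oU (smooth_mxT Sb) Sb.
  by apply/funext => u; rewrite scaleNr.
have SE : smooth_mx U (fun u => gram_schmidt (S u)).
  by apply: IH SS => u Uu; exact: posdef_schur (pG u Uu).
have Srm : smooth_mx U (fun u => (r u)%:M : 'M[R]_1).
  move=> i j; rewrite !ord1 (_ : (fun w => _) = r) //.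
  by apply/funext => w; rewrite mxE eqxx.
have SX := smooth_row_mx (smooth_mx_scale oU SNrr (smooth_mxM oU SE (smooth_mxT Sb))) SE.
exact: smooth_col_mx (smooth_row_mx Srm (smooth_mx_cst U 0)) SX.
Qed.

End SmoothFrames.

Section OrthonormalFrames.
Context {R : realType}.

(** Everything computed from an orthonormal basis by summing a quadratic form depends
    on the basis only through [e^T *m e]; this is why the choice is immaterial. *)
Lemma orthonormal_gram_inv n k (G : 'M[R]_n) (e : 'M[R]_(k, n)) :
  G \in unitmx -> row_full e -> e *m G *m e^T = 1%:M -> e^T *m e = invmx G.
Proof.
move=> uG fe eG.
suff GS : G *m (e^T *m e) = 1%:M.
  by rewrite -[LHS]mul1mx -(mulVmx uG) -mulmxA GS mulmx1.
by apply: (row_full_inj fe); rewrite !mulmxA eG mul1mx mulmx1.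
Qed.

Lemma gram_schmidt_inv n (G : 'M[R]_n) : posdef G ->
  (gram_schmidt G)^T *m gram_schmidt G = invmx G.
Proof.
move=> pG; apply: orthonormal_gram_inv (posdef_unit pG) _ (gram_schmidtP pG).
rewrite row_full_unit; have := gram_schmidtP pG; rewrite -mulmxA.
by case/mulmx1_unit.
Qed.

(** The inverse of [G] is [E^T *m E] for the Gram-Schmidt frame [E], which is already
    known to be smooth. *)
Lemma smooth_invmx d n (U : set 'rV[R]_d) (G : 'rV[R]_d -> 'M[R]_n) :
  open U -> (forall u, U u -> posdef (G u)) -> smooth_mx U G ->
  smooth_mx U (fun u => invmx (G u)).
Proof.
move=> oU pG SG; have SE := smooth_gram_schmidt oU pG SG.
apply: smooth_mx_eq (smooth_mxM oU (smooth_mxT SE) SE) => // u Uu.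
exact: gram_schmidt_inv (pG u Uu).
Qed.

Lemma orthonormal_basis_exists n k (G : 'M[R]_n) (W : 'M[R]_(k, n)) :
  posdef G -> exists e : 'M[R]_(\rank W, n), orthonormal_basis G e.
Proof.
move=> pG.
have pB := posdef_pullback pG (row_base_free W).
have gB := gram_schmidtP pB; set g := gram_schmidt _ in gB.
exists (g *m row_base W); split; first by rewrite trmx_mul -[RHS]gB; rewrite !mulmxA.
apply: eqmx_trans (eq_row_base W); apply: eqmxMfull.
by rewrite row_full_unit; move: gB; rewrite -mulmxA => /mulmx1_unit[].
Qed.

Lemma sum_inner_rows n k (B : 'M[R]_n) (e : 'M[R]_(k, n)) :
  \sum_i inner B (row i e) (row i e) = \tr (B *m (e^T *m e)).
Proof.
rewrite mulmxA mxtrace_mulC mulmxA /mxtrace; apply: eq_bigr => i _.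
rewrite /inner -row_mul mxE [RHS]mxE; apply: eq_bigr => k' _.
by congr (_ * _); rewrite !mxE.
Qed.

End OrthonormalFrames.

(** * Connection and curvature as matrices *)

(** Christoffel symbols of the first kind: the entry [(j, l)] is the scalar product of
    [nabla_i d_j] with [d_l]. *)
HB.lock Definition christoffel1 (R : realType) (m : nat) (G : 'rV[R]_m -> 'M[R]_m)
    (i : 'I_m) (y : 'rV[R]_m) : 'M[R]_m :=
  \matrix_(j, l) (2^-1 * (mpartial i G y j l + mpartial j G y i l - mpartial l G y i j)).

(** The action of [nabla_i] on the coordinate fields: the entry [(j, k)] is the
    Christoffel symbol of the second kind with upper index [k]. *)
HB.lock Definition connection_mx (R : realType) (m : nat) (G : 'rV[R]_m -> 'M[R]_m)
    (i : 'I_m) (y : 'rV[R]_m) : 'M[R]_m :=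
  christoffel1 G i y *m invmx (G y).

(** [R(d_i, d_j)] acting on row vectors by right multiplication, which reverses the
    usual order of the two products. *)
HB.lock Definition riemann_mx (R : realType) (m : nat) (G : 'rV[R]_m -> 'M[R]_m)
    (i j : 'I_m) (y : 'rV[R]_m) : 'M[R]_m :=
  mpartial i (connection_mx G j) y - mpartial j (connection_mx G i) y
  + connection_mx G j y *m connection_mx G i y
  - connection_mx G i y *m connection_mx G j y.

Definition smooth_metric (R : realType) (m : nat) (O : set 'rV[R]_m)
    (G : 'rV[R]_m -> 'M[R]_m) :=
  [/\ open O, smooth_mx O G & forall y, O y -> posdef (G y)].

Section Nabla.
Context {R : realType} {m : nat} {G : 'rV[R]_m -> 'M[R]_m}.

Lemma christoffelE i j k y : (G y)^T = G y ->
  christoffel G i j k y = connection_mx G i y j k.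
Proof.
move=> sG; rewrite connection_mx.unlock christoffel1.unlock /christoffel mxE mulr_sumr.
apply: eq_bigr => l _; rewrite mxE !mpartialE -[in X in invmx X k l]sG -trmx_inv mxE.
by rewrite [_ * (_ + _ - _) in LHS]mulrC mulrA.
Qed.

Lemma nablaE n (h : 'rV[R]_n -> 'rV[R]_m) u (X : 'rV[R]_n) (V : 'rV[R]_n -> 'rV[R]_m) dV :
  (G (h u))^T = G (h u) -> is_mderive u X V dV ->
  nabla G h X V u = dV + V u *m \sum_i (X *m jac h u) 0 i *: connection_mx G i (h u).
Proof.
move=> sG dV'; apply/rowP => k; rewrite mxE [RHS]mxE; congr (_ + _).
  exact: (@derive_val _ _ _ _ _ _ _ (dV' 0 k)).
rewrite mulmx_sumr summxE; apply: eq_bigr => i _.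
rewrite -scalemxAr [RHS]mxE [X in _ = _ * X]mxE mulr_sumr; apply: eq_bigr => j _.
by rewrite christoffelE // mulrAC mulrC (mulrC (V u 0 j)).
Qed.

Lemma is_mderive_id n (u v : 'rV[R]_n) : is_mderive u v id v.
Proof.
move=> i j; have [d E] := is_derive_id u v.
split; first by move/derivable_mxP: d; apply.
move: E; rewrite derive_mx // => /matrixP /(_ i j) <-.
by rewrite mxE.
Qed.

Lemma jac_id n (u : 'rV[R]_n) : jac id u = 1%:M.
Proof.
apply/matrixP => i j; rewrite mxE /partial.
rewrite (@derive_val _ _ _ _ _ _ _ (is_mderive_id u (delta_mx 0 i) 0 j)) !mxE eqxx /=.
by rewrite eq_sym.
Qed.

Lemma nabla_cst u (X Y : 'rV[R]_m) : (G u)^T = G u ->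
  nabla G id X (fun=> Y) u = Y *m \sum_i X 0 i *: connection_mx G i u.
Proof.
move=> sG; rewrite (@nablaE _ id _ _ _ 0) //; last exact: is_mderive_cst.
by rewrite jac_id mulmx1 add0r.
Qed.

End Nabla.

Section Connection.
Context {R : realType} {m : nat} {O : set 'rV[R]_m} {G : 'rV[R]_m -> 'M[R]_m}.
Hypothesis metG : smooth_metric O G.
Implicit Types (y : 'rV[R]_m) (i j k : 'I_m).

Let oO : open O. Proof. by case: metG. Qed.
Let SG : smooth_mx O G. Proof. by case: metG. Qed.
Let pG y : O y -> posdef (G y). Proof. by case: metG => _ _; apply. Qed.

Lemma mpartial_metric_sym i y : O y -> (mpartial i G y)^T = mpartial i G y.
Proof.
move=> Oy; apply/esym/mpartial_val.
apply: is_mderive_eq oO Oy _ (is_mderiveT (smooth_mx_partial i oO Oy SG)) => w /pG[sG _].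
exact: sG.
Qed.

(** Compatibility of the connection with the metric. *)
Lemma christoffel1_trD i y : O y ->
  christoffel1 G i y + (christoffel1 G i y)^T = mpartial i G y.
Proof.
move=> Oy; apply/matrixP => j l; rewrite christoffel1.unlock !mxE.
have S a b c : mpartial a G y b c = mpartial a G y c b.
  by rewrite -[in LHS]mpartial_metric_sym // mxE.
by rewrite (S l i j) (S j i l) (S i l j); field.
Qed.

Lemma christoffel1_sym i j l y : O y -> christoffel1 G i y j l = christoffel1 G j y i l.
Proof.
move=> Oy; rewrite christoffel1.unlock !mxE.
rewrite -[in mpartial l G y i j]mpartial_metric_sym //.
by rewrite mxE; congr (_ * (_ - _)); exact: addrC.
Qed.

Lemma invmx_sym y : O y -> (invmx (G y))^T = invmx (G y).
Proof. by move=> /pG[sG _]; rewrite trmx_inv sG. Qed.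

Lemma connection_mxM i y : O y -> connection_mx G i y *m G y = christoffel1 G i y.
Proof.
move=> Oy; rewrite connection_mx.unlock -mulmxA mulVmx ?mulmx1 //.
exact: posdef_unit (pG Oy).
Qed.

Lemma connection_mx_sym i j k y : O y ->
  connection_mx G i y j k = connection_mx G j y i k.
Proof.
move=> Oy; rewrite connection_mx.unlock !mxE; apply: eq_bigr => l _.
by rewrite christoffel1_sym.
Qed.

Lemma connection_mx_metric i y : O y ->
  connection_mx G i y *m G y + G y *m (connection_mx G i y)^T = mpartial i G y.
Proof.
move=> Oy; have [sG _] := pG Oy.
by rewrite -{2}sG -trmx_mul connection_mxM // christoffel1_trD.
Qed.

Lemma smooth_christoffel1 i : smooth_mx O (christoffel1 G i).
Proof.
have SP a : smooth_mx O (mpartial a G) by exact: smooth_mx_mpartial.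
move=> j l k; rewrite (_ : (fun w => _) = (fun w => 2^-1 * ((mpartial i G w j l +
   mpartial j G w i l) + (-1) * mpartial l G w i j))).
  apply: (of_classM oO (of_class_cst k O _)).
  apply: (of_classD oO); last exact: of_classM oO (of_class_cst k O _) (SP l i j k).
  exact: of_classD oO (SP i j l k) (SP j i l k).
by apply/funext => w; rewrite christoffel1.unlock mxE mulN1r.
Qed.

Lemma smooth_connection_mx i : smooth_mx O (connection_mx G i).
Proof.
rewrite (_ : connection_mx G i = fun y => christoffel1 G i y *m invmx (G y)).
  exact: smooth_mxM oO (smooth_christoffel1 i) (smooth_invmx oO pG SG).
by apply/funext => y; rewrite connection_mx.unlock.
Qed.

Lemma riemann_mxN i j y : riemann_mx G j i y = - riemann_mx G i j y.
Proof.
rewrite riemann_mx.unlock !opprD !opprK.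
by rewrite -!addrA addrCA; congr (_ + (_ + _)); rewrite addrC.
Qed.

Lemma riemann_mxM i j y : O y -> riemann_mx G i j y *m G y =
  mpartial i (christoffel1 G j) y - mpartial j (christoffel1 G i) y
  - christoffel1 G j y *m invmx (G y) *m (christoffel1 G i y)^T
  + christoffel1 G i y *m invmx (G y) *m (christoffel1 G j y)^T.
Proof.
move=> Oy.
have dA a b : mpartial a (connection_mx G b) y *m G y =
    mpartial a (christoffel1 G b) y
    - connection_mx G b y *m christoffel1 G a y
    - connection_mx G b y *m (christoffel1 G a y)^T.
  have D := is_mderiveM (smooth_mx_partial a oO Oy (smooth_connection_mx b))
    (smooth_mx_partial a oO Oy SG).
  have D' := is_mderive_eq oO Oy (fun w Ow => connection_mxM b Ow) D.
  rewrite (mpartial_val D') -(christoffel1_trD a Oy) mulmxDr.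
  by rewrite -[RHS]addrA -opprD addrK.
rewrite {1}riemann_mx.unlock !mulmxBl mulmxDl mulmxBl !dA.
rewrite -!(mulmxA _ _ (G y)) !connection_mxM //.
have E a b : connection_mx G a y *m (christoffel1 G b y)^T =
  christoffel1 G a y *m invmx (G y) *m (christoffel1 G b y)^T.
  by rewrite connection_mx.unlock.
rewrite !E.
set P := mpartial i _ y; set Q := mpartial j _ y.
set A := connection_mx _ _ _ *m _; set B := connection_mx _ _ _ *m christoffel1 G j y.
set C := christoffel1 G j y *m _ *m _; set D := christoffel1 G i y *m _ *m _.
apply/matrixP => a b; rewrite !mxE; ring.
Qed.

(** Adding the transpose to the formula for the lowered curvature leaves only the
    commutator of two partial derivatives of the metric. *)
Lemma riemann_mx_skew i j y : O y ->
  (riemann_mx G i j y *m G y)^T = - (riemann_mx G i j y *m G y).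
Proof.
move=> Oy; apply/eqP; rewrite -subr_eq0 opprK; apply/eqP.
have T a b : (christoffel1 G a y *m invmx (G y) *m (christoffel1 G b y)^T)^T =
   christoffel1 G b y *m invmx (G y) *m (christoffel1 G a y)^T.
  by rewrite !trmx_mul trmxK invmx_sym // mulmxA.
have dG a b : mpartial a (christoffel1 G b) y + (mpartial a (christoffel1 G b) y)^T =
    mpartial a (mpartial b G) y.
  apply/esym/mpartial_val.
  have D := smooth_mx_partial a oO Oy (smooth_christoffel1 b).
  apply: is_mderive_eq oO Oy _ (is_mderiveD D (is_mderiveT D)) => w.
  by move=> /christoffel1_trD ->.
rewrite riemann_mxM // linearD linearB linearB /= !T.
have := mpartialC i j oO Oy SG; rewrite -!dG.
set P := mpartial i _ y; set Q := mpartial j _ y.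
set C := christoffel1 G j y *m _ *m _; set D := christoffel1 G i y *m _ *m _.
move=> PQ; apply/matrixP => a b; move/matrixP/(_ a b): PQ; rewrite !mxE => /eqP.
rewrite -subr_eq0 => /eqP <-; ring.
Qed.

(** Extending vectors by constant coordinates makes both iterated covariant derivatives
    explicit, and the terms symmetric in the two directions cancel. *)
Lemma curvatureE (X Y Z y : 'rV[R]_m) : O y ->
  curvature G X Y Z y = Z *m \sum_i \sum_j (X 0 i * Y 0 j) *: riemann_mx G i j y.
Proof.
move=> Oy.
pose A (W w : 'rV[R]_m) := \sum_i W 0 i *: connection_mx G i w.
have nc W w : O w -> nabla G id W (fun=> Z) w = Z *m A W w.
  by move=> /pG[sG _]; exact: nabla_cst.
pose dA (W1 W2 : 'rV[R]_m) :=
  \sum_i W2 0 i *: \sum_j W1 0 j *: mpartial j (connection_mx G i) y.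
have dA' W1 W2 : is_mderive y W1 (A W2) (dA W1 W2).
  apply: is_mderive_sum => i.
  have := is_mderive_scale (is_derive_cst (W2 0 i) y W1)
    (smooth_mx_is_mderive W1 oO Oy (smooth_connection_mx i)).
  by rewrite scale0r add0r.
have nn W1 W2 : nabla G id W1 (nabla G id W2 (fun=> Z)) y =
    Z *m (dA W1 W2 + A W2 y *m A W1 y).
  rewrite (@nablaE _ _ G _ id y W1 _ (Z *m dA W1 W2) (proj1 (pG Oy))); last first.
    have := is_mderiveM (is_mderive_cst y W1 Z) (dA' W1 W2).
    rewrite mul0mx add0r; apply: is_mderive_eq oO Oy _ => w Ow.
    by rewrite nc.
  by rewrite jac_id mulmx1 nc // mulmxDr mulmxA.
rewrite /curvature !nn -mulmxBr; congr (_ *m _).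
have AA W1 W2 : A W2 y *m A W1 y =
   \sum_i \sum_j (W1 0 i * W2 0 j) *: (connection_mx G j y *m connection_mx G i y).
  rewrite mulmx_sumr; apply: eq_bigr => i _; rewrite mulmx_suml; apply: eq_bigr => j _.
  by rewrite -scalemxAl -scalemxAr scalerA mulrC.
have AA' : A X y *m A Y y =
   \sum_i \sum_j (X 0 i * Y 0 j) *: (connection_mx G i y *m connection_mx G j y).
  rewrite mulmx_suml; apply: eq_bigr => i _; rewrite mulmx_sumr; apply: eq_bigr => j _.
  by rewrite -scalemxAl -scalemxAr scalerA.
have dXY : dA X Y = \sum_i \sum_j (X 0 i * Y 0 j) *: mpartial i (connection_mx G j) y.
  rewrite /dA exchange_big /=; apply: eq_bigr => i _.
  rewrite scaler_sumr; apply: eq_bigr => j _; by rewrite scalerA mulrC.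
have dYX : dA Y X = \sum_i \sum_j (X 0 i * Y 0 j) *: mpartial j (connection_mx G i) y.
  rewrite /dA; apply: eq_bigr => i _.
  rewrite scaler_sumr; apply: eq_bigr => j _; by rewrite scalerA.
rewrite dXY dYX AA AA' opprD addrACA -!sumrB -big_split /=; apply: eq_bigr => i _.
rewrite -!sumrB -big_split /=; apply: eq_bigr => j _.
by rewrite riemann_mx.unlock -!scalerBr -scalerDr addrA.
Qed.

End Connection.

(** * The Gauss equation *)

(** The ambient connection along [h], in the direction of the [a]-th coordinate. *)
HB.lock Definition pullback_connection (R : realType) (n m : nat)
    (G : 'rV[R]_m -> 'M[R]_m) (h : 'rV[R]_n -> 'rV[R]_m)
    (a : 'I_n) (u : 'rV[R]_n) : 'M[R]_m :=
  \sum_i jac h u a i *: connection_mx G i (h u).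

(** The row [b] is the ambient covariant derivative, in the direction [d_a], of the
    field [h_* d_b]. *)
HB.lock Definition jac_derivative (R : realType) (n m : nat)
    (G : 'rV[R]_m -> 'M[R]_m) (h : 'rV[R]_n -> 'rV[R]_m)
    (a : 'I_n) (u : 'rV[R]_n) : 'M[R]_(n, m) :=
  mpartial a (jac h) u + jac h u *m pullback_connection G h a u.

(** The row [b] is the second fundamental form on [(d_a, d_b)]. *)
HB.lock Definition sff_mx (R : realType) (n m : nat)
    (G : 'rV[R]_m -> 'M[R]_m) (g : 'rV[R]_n -> 'M[R]_n)
    (h : 'rV[R]_n -> 'rV[R]_m) (a : 'I_n) (u : 'rV[R]_n) : 'M[R]_(n, m) :=
  jac_derivative G h a u - connection_mx g a u *m jac h u.

Section PullbackConnection.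
Context {R : realType} {n m : nat}.

Definition pullback_riemann (G : 'rV[R]_m -> 'M[R]_m) (h : 'rV[R]_n -> 'rV[R]_m)
    (a b : 'I_n) (u : 'rV[R]_n) : 'M[R]_m :=
  \sum_i \sum_j (jac h u a i * jac h u b j) *: riemann_mx G i j (h u).

(** The lowered curvature [R(d_a, d_b)] of [g], in terms of Christoffel symbols of the
    first kind.  For an induced metric their differentiability follows from that of
    the ambient metric and of [h]. *)
Definition intrinsic_riemann (g : 'rV[R]_n -> 'M[R]_n) (a b : 'I_n)
    (u : 'rV[R]_n) : 'M[R]_n :=
  mpartial a (christoffel1 g b) u - mpartial b (christoffel1 g a) u
  - christoffel1 g b u *m invmx (g u) *m (christoffel1 g a u)^T
  + christoffel1 g a u *m invmx (g u) *m (christoffel1 g b u)^T.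

Variables (U : set 'rV[R]_n) (O : set 'rV[R]_m) (h : 'rV[R]_n -> 'rV[R]_m)
  (G : 'rV[R]_m -> 'M[R]_m) (g : 'rV[R]_n -> 'M[R]_n).
Hypotheses (oU : open U) (metG : smooth_metric O G) (Sh : smooth_mx U h)
  (hU : forall u, U u -> O (h u))
  (iso : forall u, U u -> g u = jac h u *m G (h u) *m (jac h u)^T).

Let oO : open O. Proof. by case: metG. Qed.
Let SG : smooth_mx O G. Proof. by case: metG. Qed.
Let symG y : O y -> (G y)^T = G y. Proof. by case: metG => _ _ /[apply] -[]. Qed.
Local Notation J := (jac h).
Local Notation Bc := (pullback_connection G h).
Local Notation DJ := (jac_derivative G h).

Lemma smooth_jac : smooth_mx U J.
Proof.
move=> b k l; have [_ /(_ b)[_ +]] := Sh 0 k l.+1.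
by apply: of_class_eq oU _ => u Uu; rewrite mxE.
Qed.

Lemma mpartial_jacC a b k u : U u -> mpartial a J u b k = mpartial b J u a k.
Proof.
move=> Uu; rewrite 2!mpartialE.
have E c : (fun w => J w c k) = partial c (fun w => h w 0 k).
  by apply/funext => w; rewrite mxE.
by rewrite 2!E; exact: partialC oU Uu (Sh 0 k 2%N).
Qed.

Lemma mpartial_row a u : U u -> mpartial a h u = row a (J u).
Proof. by move=> Uu; apply/rowP => k; rewrite mpartialE !mxE. Qed.

(** The connection is torsion free: both the second derivatives of [h] and the
    Christoffel symbols are symmetric. *)
Lemma jac_derivativeC a b k u : U u -> DJ a u b k = DJ b u a k.
Proof.
move=> Uu; rewrite jac_derivative.unlock [LHS]mxE [RHS]mxE mpartial_jacC //.
congr (_ + _).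
rewrite [LHS]mxE [RHS]mxE pullback_connection.unlock.
under eq_bigr => j _ do rewrite summxE mulr_sumr.
under [RHS]eq_bigr => j _ do rewrite summxE mulr_sumr.
rewrite exchange_big /=; apply: eq_bigr => i _; apply: eq_bigr => j _.
rewrite [X in _ * X = _]mxE [X in _ = _ * X]mxE (connection_mx_sym metG i j k (hU Uu)).
by rewrite mulrCA.
Qed.

Lemma slice_mulmx p q (A : 'I_n -> 'M[R]_(n, p)) (C : 'M[R]_(p, q)) a b k :
  (forall a b k, A a b k = A b a k) -> (A a *m C) b k = (A b *m C) a k.
Proof. by move=> symA; rewrite !mxE; apply: eq_bigr => l _; rewrite symA. Qed.

(** Compatibility with the metric, along [h]. *)
Lemma pullback_metric_derive a u : U u ->
  is_mderive u (delta_mx 0 a) (fun w => G (h w))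
    (Bc a u *m G (h u) + G (h u) *m (Bc a u)^T).
Proof.
move=> Uu.
have := is_mderive_comp oO SG (hU Uu) (smooth_mx_partial a oU Uu Sh).
congr is_mderive; rewrite pullback_connection.unlock.
rewrite mulmx_suml linear_sum mulmx_sumr -big_split /=.
apply: eq_bigr => k _; rewrite mpartial_row // mxE -(connection_mx_metric metG k (hU Uu)).
by rewrite scalerDr linearZ /= -scalemxAl -scalemxAr.
Qed.

Definition lowered_derivative a u := DJ a u *m G (h u) *m (J u)^T.

Lemma lowered_derivative_trD a u : U u ->
  lowered_derivative a u + (lowered_derivative a u)^T = mpartial a g u.
Proof.
move=> Uu; apply/esym/mpartial_val.
have DJ' := smooth_mx_partial a oU Uu smooth_jac.
have D := is_mderiveM (is_mderiveM DJ' (pullback_metric_derive a Uu)) (is_mderiveT DJ').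
have {D} := is_mderive_eq oU Uu (fun w Uw => esym (iso Uw)) D.
congr is_mderive; rewrite /lowered_derivative !trmx_mul trmxK (symG (hU Uu)).
rewrite jac_derivative.unlock [(_ + _)^T]linearD /= trmx_mul !(mulmxDl, mulmxDr) !mulmxA.
set x1 := _ *m _; set x2 := _ *m _ *m (J u)^T; set x3 := _ *m (J u)^T.
by rewrite -!addrA; congr (_ + (_ + _)); rewrite addrC.
Qed.

(** The Koszul formula: the scalar products of [D_a V_b] with [V_d] are symmetric in [a],
    [b], and their symmetrization in [b], [d] is the derivative of [g]; this determines
    them. *)
Lemma christoffel1_pullback a u : U u -> christoffel1 g a u = lowered_derivative a u.
Proof.
move=> Uu; apply/matrixP => b d; rewrite christoffel1.unlock mxE.
have L x y z : lowered_derivative x u y z = lowered_derivative y u x z.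
  rewrite /lowered_derivative -!mulmxA.
  by apply: (slice_mulmx (A := fun x => DJ x u)) => *; exact: jac_derivativeC.
rewrite -!lowered_derivative_trD // ![(_ + _^T) _ _]mxE ![_^T _ _]mxE.
by rewrite (L a d b) (L b a d) (L b d a); field.
Qed.

Lemma jac_derivative_derive a b u : U u ->
  { D : 'M[R]_(n, m) | is_mderive u (delta_mx 0 a) (DJ b) D &
    D = mpartial a (mpartial b J) u + mpartial a J u *m Bc b u
      + J u *m (\sum_i mpartial a J u b i *: connection_mx G i (h u)
                + \sum_i \sum_j (J u a i * J u b j) *:
                    mpartial i (connection_mx G j) (h u)) }.
Proof.
move=> Uu; eexists; last reflexivity.
have DJ' := smooth_mx_partial a oU Uu smooth_jac.
have DBc : is_mderive u (delta_mx 0 a) (Bc b)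
    (\sum_i mpartial a J u b i *: connection_mx G i (h u)
     + \sum_i \sum_j (J u a i * J u b j) *: mpartial i (connection_mx G j) (h u)).
  rewrite [X in _ + X]exchange_big -big_split /=.
  have -> : Bc b = fun w => \sum_i J w b i *: connection_mx G i (h w).
    by apply/funext => w; rewrite pullback_connection.unlock.
  apply: is_mderive_sum => i.
  have Dc := is_mderive_comp oO (smooth_connection_mx metG i) (hU Uu)
    (smooth_mx_partial a oU Uu Sh).
  have := is_mderive_scale (DJ' b i) Dc; congr is_mderive; congr (_ + _).
  rewrite scaler_sumr; apply: eq_bigr => k _.
  by rewrite mpartial_row // [(row _ _) _ _]mxE scalerA mulrC.
have -> : DJ b = fun w => mpartial b J w + J w *m Bc b w.
  by apply/funext => w; rewrite jac_derivative.unlock.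
have := is_mderiveD (smooth_mx_partial a oU Uu (smooth_mx_mpartial b oU smooth_jac))
  (is_mderiveM DJ' DBc).
by rewrite addrA.
Qed.

(** Covariant derivatives along [h] fail to commute by the ambient curvature; second
    and third derivatives of [h] cancel by symmetry. *)
Lemma ricci_identity a b u Dab Dba : U u ->
  is_mderive u (delta_mx 0 a) (DJ b) Dab -> is_mderive u (delta_mx 0 b) (DJ a) Dba ->
  (Dab + DJ b u *m Bc a u) - (Dba + DJ a u *m Bc b u) = J u *m pullback_riemann G h a b u.
Proof.
move=> Uu /mpartial_val <- /mpartial_val <-.
have [D1 /mpartial_val -> ->] := jac_derivative_derive a b Uu.
have [D2 /mpartial_val -> ->] := jac_derivative_derive b a Uu.
rewrite (mpartialC b a oU Uu smooth_jac).
have -> : \sum_i mpartial b J u a i *: connection_mx G i (h u) =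
    \sum_i mpartial a J u b i *: connection_mx G i (h u).
  by apply: eq_bigr => i _; rewrite mpartial_jacC.
have E : pullback_riemann G h a b u =
  \sum_i \sum_j (J u a i * J u b j) *: mpartial i (connection_mx G j) (h u)
  - \sum_i \sum_j (J u b i * J u a j) *: mpartial i (connection_mx G j) (h u)
  + (Bc b u *m Bc a u - Bc a u *m Bc b u).
  rewrite /pullback_riemann.
  have -> : Bc b u *m Bc a u = \sum_i \sum_j (J u a i * J u b j) *:
      (connection_mx G j (h u) *m connection_mx G i (h u)).
    rewrite pullback_connection.unlock mulmx_sumr; apply: eq_bigr => i _.
    rewrite mulmx_suml; apply: eq_bigr => j _.
    by rewrite -scalemxAl -scalemxAr scalerA mulrC.
  have -> : Bc a u *m Bc b u = \sum_i \sum_j (J u a i * J u b j) *: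
      (connection_mx G i (h u) *m connection_mx G j (h u)).
    rewrite pullback_connection.unlock mulmx_suml; apply: eq_bigr => i _.
    rewrite mulmx_sumr; apply: eq_bigr => j _.
    by rewrite -scalemxAl -scalemxAr scalerA.
  have -> : \sum_i \sum_j (J u b i * J u a j) *: mpartial i (connection_mx G j) (h u) =
      \sum_i \sum_j (J u a i * J u b j) *: mpartial j (connection_mx G i) (h u).
    by rewrite exchange_big; apply: eq_bigr => i _; apply: eq_bigr => j _; rewrite mulrC.
  rewrite -!sumrB -big_split /=; apply: eq_bigr => i _.
  rewrite -!sumrB -big_split /=; apply: eq_bigr => j _.
  by rewrite riemann_mx.unlock -!scalerBr -scalerDr addrA.
rewrite E jac_derivative.unlock !(mulmxDl, mulmxDr, mulmxN) !mulmxA.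
have mx_id (x1 x2 x3 x4 x5 x6 x7 x8 : 'M[R]_(n, m)) :
    x1 + x2 + (x4 + x5) + (x3 + x7) - (x1 + x3 + (x4 + x6) + (x2 + x8)) =
    x5 - x6 + (x7 - x8).
  by apply/matrixP => i j; rewrite !mxE; ring.
exact: mx_id.
Qed.

Lemma lowered_derivative_derive a b u Dab : U u ->
  is_mderive u (delta_mx 0 a) (DJ b) Dab ->
  mpartial a (christoffel1 g b) u =
    (Dab + DJ b u *m Bc a u) *m G (h u) *m (J u)^T + DJ b u *m G (h u) *m (DJ a u)^T.
Proof.
move=> Uu D; apply: mpartial_val.
have DJ' := smooth_mx_partial a oU Uu smooth_jac.
have {D} D := is_mderiveM (is_mderiveM D (pullback_metric_derive a Uu)) (is_mderiveT DJ').
have {D} := is_mderive_eq oU Uu (fun w Uw => esym (christoffel1_pullback b Uw)) D.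
congr is_mderive; move: (jac_derivative G h b u) => Db; rewrite jac_derivative.unlock.
rewrite [(_ + _)^T]linearD /= trmx_mul !(mulmxDl, mulmxDr) !mulmxA.
by rewrite -!addrA; congr (_ + (_ + _)); exact: addrC.
Qed.

Lemma sff_mx_normal a u : U u -> g u \in unitmx ->
  sff_mx G g h a u *m G (h u) *m (J u)^T = 0.
Proof.
move=> Uu gu; rewrite sff_mx.unlock !mulmxBl -[X in X - _]/(lowered_derivative a u).
rewrite -(christoffel1_pullback a Uu) connection_mx.unlock.
rewrite -!mulmxA (mulmxA (J u)) -iso //.
by rewrite mulVmx // mulmx1 subrr.
Qed.

Lemma sff_mxC a b k u : U u -> sff_mx G g h a u b k = sff_mx G g h b u a k.
Proof.
move=> Uu; rewrite sff_mx.unlock [LHS]mxE [RHS]mxE jac_derivativeC //; congr (_ + _).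
rewrite [LHS]mxE [RHS]mxE connection_mx.unlock -!mulmxA; congr (- _).
apply: (slice_mulmx (A := fun a => christoffel1 g a u)) => x y z.
rewrite (christoffel1_pullback x Uu) (christoffel1_pullback y Uu).
rewrite /lowered_derivative -!mulmxA.
by apply: (slice_mulmx (A := fun x => DJ x u)) => *; exact: jac_derivativeC.
Qed.

(** Pythagoras: the tangential part of [D_a V_b] is given by the connection of [g], and
    [sigma] is normal. *)
Lemma jac_derivative_pairing a b u : U u -> g u \in unitmx ->
  DJ b u *m G (h u) *m (DJ a u)^T =
  christoffel1 g b u *m invmx (g u) *m (christoffel1 g a u)^T
  + sff_mx G g h b u *m G (h u) *m (sff_mx G g h a u)^T.
Proof.
move=> Uu gu.
have E c : DJ c u = connection_mx g c u *m J u + sff_mx G g h c u.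
  by rewrite sff_mx.unlock addrC subrK.
have N c : J u *m G (h u) *m (sff_mx G g h c u)^T = 0.
  apply: trmx_inj; rewrite !trmx_mul trmxK trmx0 (symG (hU Uu)) mulmxA.
  exact: sff_mx_normal.
rewrite !E [(_ + _)^T]linearD /= trmx_mul !(mulmxDl, mulmxDr) !mulmxA.
rewrite (_ : connection_mx g b u *m J u *m G (h u) *m (sff_mx G g h a u)^T = 0);
  last first.
  by rewrite -!mulmxA (mulmxA (J u)) N mulmx0.
rewrite (sff_mx_normal b Uu gu) mul0mx addr0 add0r; congr (_ + _).
rewrite -(mulmxA (connection_mx g b u)) -(mulmxA (connection_mx g b u)) -iso //.
have sg : (g u)^T = g u by rewrite iso // !trmx_mul trmxK (symG (hU Uu)) mulmxA.
rewrite connection_mx.unlock trmx_mul trmx_inv sg -!mulmxA; congr (_ *m _).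
by rewrite !mulmxA mulVmx // mul1mx.
Qed.

(** Antisymmetrize the derivative of the scalar products of [D_b V_c] with [V_d]: the second
    covariant derivatives give the ambient curvature, and the products of first ones
    split into tangential and normal parts. *)
Lemma gauss_equation a b u : U u -> g u \in unitmx ->
  J u *m pullback_riemann G h a b u *m G (h u) *m (J u)^T =
  intrinsic_riemann g a b u
  - sff_mx G g h b u *m G (h u) *m (sff_mx G g h a u)^T
  + sff_mx G g h a u *m G (h u) *m (sff_mx G g h b u)^T.
Proof.
move=> Uu gu.
have [D1 D1' _] := jac_derivative_derive a b Uu.
have [D2 D2' _] := jac_derivative_derive b a Uu.
rewrite -(ricci_identity Uu D1' D2') !mulmxBl /intrinsic_riemann.
rewrite (lowered_derivative_derive Uu D1') (lowered_derivative_derive Uu D2').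
rewrite !jac_derivative_pairing //.
set x1 := _ *m (J u)^T; set x2 := (D2 + _) *m _ *m (J u)^T.
set x3 := _ *m (christoffel1 g a u)^T; set x4 := _ *m (christoffel1 g b u)^T.
set x5 := _ *m (sff_mx G g h a u)^T; set x6 := _ *m (sff_mx G g h b u)^T.
by apply/matrixP => i j; rewrite !mxE; ring.
Qed.

End PullbackConnection.

(** * Warped metrics *)

Section Projections.
Context {R : realType} {n1 n2 : nat}.
Implicit Types (u : 'rV[R]_(n1 + n2)).

Lemma open_split_domain (A : set 'rV[R]_n1) (B : set 'rV[R]_n2) :
  open A -> open B -> open [set u : 'rV[R]_(n1 + n2) | A (lsubmx u) /\ B (rsubmx u)].
Proof.
move=> oA oB; apply: openI; apply: open_comp => // u _.
  exact: continuous_lsubmx.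
exact: continuous_rsubmx.
Qed.

(** Used for functions of the coordinates of one factor, in the directions of the
    other factor. *)
Lemma is_derive_cst_along (V : normedModType R) (F : V -> R) (u0 v : V) :
  (forall t, F (t *: v + u0) = F u0) -> is_derive u0 v F 0.
Proof.
move=> cF; have u0E : 0 *: v + u0 = u0 by rewrite scale0r add0r.
have := iffRL (@is_derive_line R V F u0 v 0 0); rewrite u0E; apply.
rewrite (_ : (fun s => _) = fun=> F u0); first exact: is_derive_cst.
by apply/funext => s; rewrite cF.
Qed.

Lemma lsubmx_line t (v : 'rV[R]_(n1 + n2)) u :
  lsubmx (t *: v + u) = t *: lsubmx v + lsubmx u.
Proof. by rewrite linearP. Qed.

Lemma rsubmx_line t (v : 'rV[R]_(n1 + n2)) u :
  rsubmx (t *: v + u) = t *: rsubmx v + rsubmx u.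
Proof. by rewrite linearP. Qed.

Lemma lsubmx_delta_l i :
  lsubmx (delta_mx 0 (lshift n2 i) : 'rV[R]_(n1 + n2)) = delta_mx 0 i.
Proof. by apply/rowP => j; rewrite !mxE (inj_eq (@lshift_inj _ _)). Qed.

Lemma lsubmx_delta_r i : lsubmx (delta_mx 0 (rshift n1 i) : 'rV[R]_(n1 + n2)) = 0.
Proof. by apply/rowP => j; rewrite !mxE eq_lrshift andbF. Qed.

Lemma rsubmx_delta_l i : rsubmx (delta_mx 0 (lshift n2 i) : 'rV[R]_(n1 + n2)) = 0.
Proof. by apply/rowP => j; rewrite !mxE eq_rlshift andbF. Qed.

Lemma is_derive_lsubmx (F : 'rV[R]_n1 -> R) u i d :
  is_derive (lsubmx u) (delta_mx 0 i) F d ->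
  is_derive u (delta_mx 0 (lshift n2 i)) (fun w => F (lsubmx w)) d.
Proof.
move=> dF; have uE (v : 'rV[R]_(n1 + n2)) : 0 *: v + u = u by rewrite scale0r add0r.
have := iffRL (@is_derive_line R _ (fun w => F (lsubmx w)) u
  (delta_mx 0 (lshift n2 i)) 0 d).
rewrite uE; apply.
rewrite (_ : (fun s => _) = fun s => F (s *: delta_mx 0 i + lsubmx u)).
  by apply: (iffLR (@is_derive_line R _ F _ _ 0 d)); rewrite scale0r add0r.
by apply/funext => s; rewrite lsubmx_line lsubmx_delta_l.
Qed.

Lemma partial_lsubmx (F : 'rV[R]_n1 -> R) u i :
  partial (lshift n2 i) (fun w => F (lsubmx w)) u = partial i F (lsubmx u).
Proof.
rewrite /partial /derive; congr (lim (_ @ 0^')); apply/funext => t /=.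
by rewrite lsubmx_line lsubmx_delta_l.
Qed.

Lemma mpartial_lsubmx p q (F : 'rV[R]_n1 -> 'M[R]_(p, q)) u i :
  mpartial (lshift n2 i) (fun w => F (lsubmx w)) u = mpartial i F (lsubmx u).
Proof.
by apply/matrixP => a b; rewrite 2!mpartialE (partial_lsubmx (fun w => F w a b)).
Qed.

Lemma mpartial_lsubmx_r p q (F : 'rV[R]_n1 -> 'M[R]_(p, q)) u i :
  mpartial (rshift n1 i) (fun w => F (lsubmx w)) u = 0.
Proof.
apply: mpartial_val => a b; rewrite mxE; apply: is_derive_cst_along => t.
by rewrite lsubmx_line lsubmx_delta_r scaler0 add0r.
Qed.

Lemma is_mderive_rsubmx_l p q (F : 'rV[R]_n2 -> 'M[R]_(p, q)) u i :
  is_mderive u (delta_mx 0 (lshift n2 i)) (fun w => F (rsubmx w)) 0.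
Proof.
move=> a b; rewrite mxE; apply: is_derive_cst_along => t.
by rewrite rsubmx_line rsubmx_delta_l scaler0 add0r.
Qed.

Lemma mpartial_block_diag d p1 p2 q1 q2 (A : 'rV[R]_d -> 'M[R]_(p1, q1))
    (B : 'rV[R]_d -> 'M[R]_(p2, q2)) a (u : 'rV[R]_d) :
  mpartial a (fun w => block_mx (A w) 0 0 (B w)) u =
  block_mx (mpartial a A u) 0 0 (mpartial a B u).
Proof.
have D0 : partial a (fun=> 0) u = 0 :> R by exact: derive_cst.
apply/matrixP => i j; rewrite mpartialE; case: (split_ordP i) => i' ->;
  case: (split_ordP j) => j' ->.
- rewrite block_mxEul mpartialE; congr (partial a _ u).
  by apply/funext => w; rewrite block_mxEul.
- rewrite block_mxEur mxE -[RHS]D0; congr (partial a _ u).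
  by apply/funext => w; rewrite block_mxEur mxE.
- rewrite block_mxEdl mxE -[RHS]D0; congr (partial a _ u).
  by apply/funext => w; rewrite block_mxEdl mxE.
- rewrite block_mxEdr mpartialE; congr (partial a _ u).
  by apply/funext => w; rewrite block_mxEdr.
Qed.

Lemma mpartial_dlsubmx d p1 p2 q1 q2 (F : 'rV[R]_d -> 'M[R]_(p1 + p2, q1 + q2)) a
    (u : 'rV[R]_d) :
  dlsubmx (mpartial a F u) = mpartial a (fun w => dlsubmx (F w)) u.
Proof.
apply/matrixP => i j; rewrite [RHS]mpartialE mxE mxE mpartialE; congr (partial a _ u).
by apply/funext => w; rewrite !mxE.
Qed.

End Projections.

HB.lock Definition gradient_row (R : realType) (n : nat) (phi : 'rV[R]_n -> R)
    (y : 'rV[R]_n) : 'rV[R]_n := \row_k partial k phi y.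

(** The row [i] of the covariant Hessian, [d_i d_j phi - Gamma^k_ij d_k phi]. *)
HB.lock Definition hessian_row (R : realType) (n : nat) (G : 'rV[R]_n -> 'M[R]_n)
    (phi : 'rV[R]_n -> R) (i : 'I_n) (y : 'rV[R]_n) : 'rV[R]_n :=
  mpartial i (gradient_row phi) y - gradient_row phi y *m (connection_mx G i y)^T.

Lemma gradient_rowE (R : realType) (n : nat) (phi : 'rV[R]_n -> R) y k :
  gradient_row phi y 0 k = partial k phi y.
Proof. by rewrite gradient_row.unlock mxE. Qed.

Definition warped_metric (R : realType) (n1 n2 : nat) (G1 : 'rV[R]_n1 -> 'M[R]_n1)
    (G2 : 'rV[R]_n2 -> 'M[R]_n2) (phi : 'rV[R]_n1 -> R) (u : 'rV[R]_(n1 + n2)) :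
    'M[R]_(n1 + n2) :=
  block_mx (G1 (lsubmx u)) 0 0 (phi (lsubmx u) ^+ 2 *: G2 (rsubmx u)).

Section WarpedMetric.
Context {R : realType} {n1 n2 : nat}.
Variables (U1 : set 'rV[R]_n1) (U2 : set 'rV[R]_n2) (G1 : 'rV[R]_n1 -> 'M[R]_n1)
  (G2 : 'rV[R]_n2 -> 'M[R]_n2) (phi : 'rV[R]_n1 -> R).
Hypotheses (metG1 : smooth_metric U1 G1) (oU2 : open U2)
  (pG2 : forall y, U2 y -> posdef (G2 y)) (Sphi : smooth_on U1 phi)
  (phi_gt0 : forall y, U1 y -> 0 < phi y).

Let oU1 : open U1. Proof. by case: metG1. Qed.
Let pG1 y : U1 y -> posdef (G1 y). Proof. by case: metG1 => _ _; apply. Qed.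
Let W := [set u : 'rV[R]_(n1 + n2) | U1 (lsubmx u) /\ U2 (rsubmx u)].
Local Notation g := (warped_metric G1 G2 phi).
Local Notation dphi := (gradient_row phi).

Let oW : open W. Proof. exact: open_split_domain. Qed.

Lemma smooth_gradient_row : smooth_mx U1 dphi.
Proof.
move=> i j k; have [_ /(_ j)[_ +]] := Sphi k.+1.
by apply: of_class_eq oU1 _ => y _; rewrite ord1 gradient_rowE.
Qed.

Lemma is_derive_warping u i : W u ->
  is_derive u (delta_mx 0 (lshift n2 i)) (fun w => phi (lsubmx w)) (dphi (lsubmx u) 0 i).
Proof.
move=> [U1u _]; apply: is_derive_lsubmx; rewrite gradient_rowE; apply: derivableP.
by have [_ /(_ i)[+ _]] := Sphi 1; apply.
Qed.

Lemma warped_metric_partial_l u i : W u -> mpartial (lshift n2 i) g u =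
  block_mx (mpartial i G1 (lsubmx u)) 0 0
    ((2 * phi (lsubmx u) * dphi (lsubmx u) 0 i) *: G2 (rsubmx u)).
Proof.
move=> Wu; rewrite mpartial_block_diag mpartial_lsubmx; congr (block_mx _ _ _ _).
apply: mpartial_val.
have d := is_derive_warping i Wu.
have := is_mderive_scale (is_derive_mul d d) (is_mderive_rsubmx_l G2 u i).
rewrite scaler0 addr0.
move: (dphi _ 0 i) => c.
by rewrite (_ : 2 * _ * c = c * phi (lsubmx u) + phi (lsubmx u) * c) //; ring.
Qed.

Lemma warped_metric_partial_r u i :
  mpartial (rshift n1 i) g u = block_mx 0 0 0 (drsubmx (mpartial (rshift n1 i) g u)).
Proof. by rewrite mpartial_block_diag block_mxKdr mpartial_lsubmx_r. Qed.

Lemma christoffel1_warped_l u i : W u -> christoffel1 g (lshift n2 i) u =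
  block_mx (christoffel1 G1 i (lsubmx u)) 0 0
    ((phi (lsubmx u) * dphi (lsubmx u) 0 i) *: G2 (rsubmx u)).
Proof.
move=> Wu; rewrite christoffel1.unlock; apply/matrixP => j l; rewrite mxE.
case: (split_ordP j) => j' ->; case: (split_ordP l) => l' ->.
- rewrite block_mxEul mxE.
  by rewrite !warped_metric_partial_l // !block_mxEul.
- rewrite block_mxEur mxE.
  rewrite !warped_metric_partial_l // (warped_metric_partial_r u l').
  by rewrite !block_mxEur block_mxEul !mxE addr0 subr0 mulr0.
- rewrite block_mxEdl mxE.
  rewrite !warped_metric_partial_l // (warped_metric_partial_r u j').
  by rewrite block_mxEdl block_mxEul block_mxEur !mxE addr0 subr0 mulr0.
- rewrite block_mxEdr.
  rewrite !warped_metric_partial_l //.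
  rewrite (warped_metric_partial_r u j') (warped_metric_partial_r u l').
  by rewrite !block_mxEur block_mxEdr !mxE addr0 subr0; field.
Qed.

Lemma christoffel1_warped_r u i : W u -> christoffel1 g (rshift n1 i) u =
  block_mx 0 (phi (lsubmx u) *: ((dphi (lsubmx u))^T *m row i (G2 (rsubmx u))))
    (- phi (lsubmx u) *: ((row i (G2 (rsubmx u)))^T *m dphi (lsubmx u)))
    (drsubmx (christoffel1 g (rshift n1 i) u)).
Proof.
move=> Wu; rewrite -[LHS]submxK; congr (block_mx _ _ _ _);
  apply/matrixP => j l; rewrite christoffel1.unlock !(mxE, big_ord1).
- rewrite !warped_metric_partial_l // (warped_metric_partial_r u i).
  by rewrite !block_mxEdl block_mxEul !mxE addr0 subr0 mulr0.
- rewrite !warped_metric_partial_l //.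
  rewrite (warped_metric_partial_r u i) (warped_metric_partial_r u l).
  by rewrite block_mxEur block_mxEdr block_mxEdl !mxE; field.
- rewrite !warped_metric_partial_l //.
  rewrite (warped_metric_partial_r u i) (warped_metric_partial_r u j).
  by rewrite block_mxEdr !block_mxEdl !mxE; field.
Qed.

Lemma warped_metric_inv u : W u -> g u \in unitmx /\
  invmx (g u) = block_mx (invmx (G1 (lsubmx u))) 0 0
    (phi (lsubmx u) ^- 2 *: invmx (G2 (rsubmx u))).
Proof.
move=> [U1u U2u]; have u1 := posdef_unit (pG1 U1u); have u2 := posdef_unit (pG2 U2u).
have p2 : phi (lsubmx u) ^+ 2 \is a GRing.unit.
  by rewrite unitfE expf_neq0 // gt_eqF // phi_gt0.
have uB : phi (lsubmx u) ^+ 2 *: G2 (rsubmx u) \in unitmx by rewrite unitmxZ.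
have uW : g u \in unitmx by rewrite block_diag_mx_unit u1.
by split=> //; rewrite invmx_block_diag // invmxZ.
Qed.

(** The mixed curvature of a warped metric is [- phi Hess phi] in the leaf directions times
    the fibre metric: the terms quadratic in the gradient of [phi] cancel, since the
    derivative of [phi] in the mixed Christoffel symbols is compensated by the product of
    Christoffel symbols through the fibres. *)
Lemma intrinsic_riemann_warped u i j : W u ->
  dlsubmx (intrinsic_riemann g (lshift n2 i) (rshift n1 j) u) =
  - phi (lsubmx u) *: ((row j (G2 (rsubmx u)))^T *m hessian_row G1 phi i (lsubmx u)).
Proof.
move=> Wu; have [U1u U2u] := Wu.
have dlD (A B : 'M[R]_(n1 + n2)) : dlsubmx (A + B) = dlsubmx A + dlsubmx B.
  by apply/matrixP => a b; rewrite !mxE.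
have dlN (A : 'M[R]_(n1 + n2)) : dlsubmx (- A) = - dlsubmx A.
  by apply/matrixP => a b; rewrite !mxE.
rewrite /intrinsic_riemann !(dlD, dlN).
have T1 : dlsubmx (mpartial (lshift n2 i) (christoffel1 g (rshift n1 j)) u) =
   - dphi (lsubmx u) 0 i *: ((row j (G2 (rsubmx u)))^T *m dphi (lsubmx u)) +
   - phi (lsubmx u) *: ((row j (G2 (rsubmx u)))^T *m mpartial i dphi (lsubmx u)).
  rewrite mpartial_dlsubmx; apply: mpartial_val.
  have d := is_derive_warping i Wu.
  have dG := is_mderive_rsubmx_l (fun w => (row j (G2 w))^T) u i.
  have dgr : is_mderive u (delta_mx 0 (lshift n2 i)) (fun w => dphi (lsubmx w))
      (mpartial i dphi (lsubmx u)).
    move=> a b; apply: (@is_derive_lsubmx _ _ _ (fun w => dphi w a b)).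
    exact: smooth_mx_partial i oU1 U1u smooth_gradient_row a b.
  have := is_mderive_scale (is_deriveN d) (is_mderiveM dG dgr).
  rewrite mul0mx add0r => D.
  apply: is_mderive_eq oW Wu _ D => w Ww.
  by rewrite christoffel1_warped_r // block_mxKdl.
have T2 : dlsubmx (mpartial (rshift n1 j) (christoffel1 g (lshift n2 i)) u) = 0.
  rewrite mpartial_dlsubmx; apply: mpartial_val.
  apply: is_mderive_eq oW Wu _ (is_mderive_cst _ _ _) => w Ww.
  by rewrite christoffel1_warped_l // block_mxKdl.
have sG1 : (invmx (G1 (lsubmx u)))^T = invmx (G1 (lsubmx u)).
  exact: invmx_sym metG1 _ U1u.
have [_ ->] := warped_metric_inv Wu.
rewrite christoffel1_warped_l // [christoffel1 g (rshift n1 j) u]christoffel1_warped_r //.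
set Z := drsubmx _; rewrite !tr_block_mx !mulmx_block !block_mxKdl T1 T2.
rewrite !(mul0mx, mulmx0, addr0, add0r, trmx0, subr0).
rewrite hessian_row.unlock mulmxBr connection_mx.unlock trmx_mul sG1.
have := phi_gt0 U1u; have := posdef_unit (pG2 U2u); move: (phi _) (dphi _ 0 i).
move: (row j (G2 (rsubmx u))) => r; move: (G2 (rsubmx u)) => B.
move: (dphi (lsubmx u)) => gr; move: (mpartial i dphi _) => dgr.
move: (invmx (G1 _)) (christoffel1 G1 i _)^T => A L f d uB f0.
rewrite [(_ *: _)^T]linearZ /= trmx_mul trmxK scalerBr.
rewrite -!scalemxAl -!scalemxAr -!scalemxAl.
rewrite mulmxV // mul1mx !scalerA !mulmxA !scaleNr !opprK.
(* The products of Christoffel symbols through the fibres give back the term quadratic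
   in the gradient. *)
rewrite (_ : f * d * (f / f ^+ 2) = d); last by field; rewrite gt_eqF.
by rewrite addrC !addrA subrr add0r.
Qed.

End WarpedMetric.

(** * The Laplacian as the trace of the Hessian *)

Section ChartFacts.
Context {R : realType}.

Lemma chart_metric n (M : atlas R n) (a : chart_index M) :
  riemannian_manifold M -> smooth_metric (img a) (gram a).
Proof.
move=> [[_ _ charts _ _] [Sg sg g0 _]]; split.
- by have [_ ? _ _ _] := charts a.
- exact: Sg.
- by move=> y ay; split; [exact: sg|move=> X; exact: g0].
Qed.

Lemma coord_at_img n (M : atlas R n) (p : M) : smooth_manifold M ->
  img (chart_at p) (coord_at p).
Proof. by move=> [_ _ _ dom_at _]; exists p. Qed.

Lemma param_coord_at n (M : atlas R n) (p : M) : smooth_manifold M ->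
  param (chart_at p) (coord_at p) = p.
Proof.
by move=> [_ _ charts dom_at _]; have [_ _ + _ _] := charts (chart_at p); apply.
Qed.

Lemma posdef_gram_at n (M : atlas R n) (p : M) :
  riemannian_manifold M -> posdef (gram_at p).
Proof.
move=> hM; have [_ _] := chart_metric (chart_at p) hM; apply.
by case: hM => /(coord_at_img p).
Qed.

Definition hessian_mx n (G : 'rV[R]_n -> 'M[R]_n) (phi : 'rV[R]_n -> R)
    (y : 'rV[R]_n) : 'M[R]_n :=
  \matrix_i hessian_row G phi i y.

Lemma derive_gradient_row n (U : set 'rV[R]_n) (phi : 'rV[R]_n -> R) u v :
  open U -> smooth_on U phi -> U u -> 'D_v phi u = (v *m (gradient_row phi u)^T) 0 0.
Proof.
move=> oU Sphi Uu; have [phi_diff grad] := C1_is_diff oU Uu (Sphi 1).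
rewrite deriveE // grad mxE; apply: eq_bigr => k _.
by rewrite mxE gradient_rowE.
Qed.

(** The derivatives of the frame occur in both terms of the definition and cancel, which
    leaves the Hessian on an orthonormal frame.  That a smooth frame exists matters,
    because the definition picks an arbitrary value otherwise. *)
Lemma laplacian_hessian n (M : atlas R n) (f : M -> R) (q : M) :
  riemannian_manifold M -> smooth_function f ->
  laplacian f q =
  - \tr (hessian_mx (gram (chart_at q)) (f \o param (chart_at q)) (coord_at q)
         *m invmx (gram_at q)).
Proof.
move=> hM Sf; have metG := chart_metric (chart_at q) hM; have [oI SG pG] := metG.
have Iq := coord_at_img q (proj1 hM).
rewrite /laplacian; set G := gram (chart_at q) in metG SG pG *.
set phi := f \o param (chart_at q); set E := xget _ _.
have [U [oU Uq UI SE EE]] : local_orthonormal_frame q E.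
  rewrite /E; apply: xgetPex.
  exists (fun u => gram_schmidt (G u)), (img (chart_at q)); split=> //.
    exact: smooth_gram_schmidt oI pG SG.
  by move=> u Iu; exact: gram_schmidtP (pG u Iu).
set u := coord_at q in Iq Uq *.
have Sphi : smooth_on (img (chart_at q)) phi by exact: Sf.
have pGu := pG u Iq.
have EiG : (E u)^T *m E u = invmx (G u).
  apply: orthonormal_gram_inv (posdef_unit pGu) _ (EE u Uq).
  by rewrite row_full_unit; have := EE u Uq; rewrite -mulmxA => /mulmx1_unit[].
rewrite -[gram_at q]/(G u) -EiG -sum_inner_rows -sumrN; apply: eq_bigr => j _.
set v := row j (E u).
have Srow : smooth_mx U (fun w => row j (E w)).
  move=> i k; rewrite (_ : (fun w => _) = fun w => E w j k); first exact: SE.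
  by apply/funext => w; rewrite mxE.
have dv := smooth_mx_is_mderive v oU Uq Srow; set dE := \sum_a _ in dv.
have dg := smooth_mx_is_mderive v oI Iq (smooth_gradient_row metG Sphi).
set dgr := \sum_a _ in dg.
rewrite (nablaE (h := id) (proj1 pGu) dv) jac_id mulmx1 -/v.
rewrite (derive_gradient_row _ oI Sphi Iq).
have D := is_mderiveM dv (is_mderiveT dg).
have -> : 'D_v (fun w => 'D_(row j (E w)) phi w) u =
    (dE *m (gradient_row phi u)^T + v *m dgr^T) 0 0.
  rewrite -(@derive_val _ _ _ _ _ _ _ (D 0 0)); apply: near_eq_derive.
  have nU : nbhs u U by exact: open_nbhs_nbhs.
  near=> w; rewrite (derive_gradient_row _ oI Sphi) //.
  by apply: UI; near: w.
have entryD (A B : 'M[R]_1) : (A + B) 0 0 = A 0 0 + B 0 0 by rewrite mxE.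
have entryN (A : 'M[R]_1) : (- A) 0 0 = - A 0 0 by rewrite mxE.
(* Here the derivatives of the frame cancel. *)
rewrite mulmxDl 2!entryD opprD addrACA subrr add0r.
set C := \sum_i _.
have vH : v *m hessian_mx G phi u = dgr - gradient_row phi u *m C^T.
  rewrite mulmx_sum_row /dgr /C linear_sum mulmx_sumr -sumrB; apply: eq_bigr => i _.
  by rewrite rowK hessian_row.unlock linearZ /= -scalemxAr scalerBr.
rewrite /inner vH.
rewrite [in RHS]entry_tr11 trmx_mul trmxK [(_ - _)^T]linearB /=.
rewrite trmx_mul trmxK mulmxBr mulmxA.
by rewrite entryD entryN opprB.
Unshelve. all: by end_near. Qed.

End ChartFacts.

(** * Sums over orthonormal bases *)

Section SectionalSums.
Context {R : realType}.

(** Symmetric summation over ordered pairs is bilinear, unlike the sum over [i < j]. *)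
Lemma sum_pairs k (F : 'I_k -> 'I_k -> R) :
  (forall i j, F i j = F j i) -> (forall i, F i i = 0) ->
  \sum_i \sum_j F i j = 2 * \sum_(i < k) \sum_(j < k | (i < j)%N) F i j.
Proof.
move=> symF F0.
pose L (i j : 'I_k) := if (i < j)%N then F i j else 0.
have E : \sum_(i < k) \sum_(j < k | (i < j)%N) F i j = \sum_i \sum_j L i j.
  by apply: eq_bigr => i _; rewrite big_mkcond.
have -> : \sum_i \sum_j F i j = \sum_i \sum_j L i j + \sum_i \sum_j L j i.
  rewrite -big_split /=; apply: eq_bigr => i _.
  rewrite -big_split /=; apply: eq_bigr => j _.
  rewrite /L; case: ltngtP => [ij|ji|/val_inj ->]; rewrite ?addr0 ?add0r //.
by rewrite E [X in _ + X]exchange_big /= mulrDl !mul1r.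
Qed.

(** A sum of values of a quadratic form over the rows of [e] only sees [e^T *m e]; this is
    applied once in each argument of [T]. *)
Lemma sum_inner_quadratic_split n k k1 k2 (e : 'M[R]_(k, n)) (e1 : 'M[R]_(k1, n))
    (e2 : 'M[R]_(k2, n)) (T : 'rV[R]_n -> 'rV[R]_n -> R) :
  e^T *m e = e1^T *m e1 + e2^T *m e2 ->
  (forall X Y, T X Y = T Y X) ->
  (forall Y, exists B, forall X, T X Y = inner B X X) ->
  \sum_i \sum_j T (row i e) (row j e) =
  \sum_i \sum_j T (row i e1) (row j e1) + \sum_i \sum_j T (row i e2) (row j e2)
  + 2 * \sum_i \sum_j T (row i e1) (row j e2).
Proof.
move=> eE symT quadT.
have split Y : \sum_i T (row i e) Y = \sum_i T (row i e1) Y + \sum_i T (row i e2) Y.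
  have [B BE] := quadT Y.
  rewrite [LHS](eq_bigr _ (fun i _ => BE (row i e))).
  rewrite [X in X + _](eq_bigr _ (fun i _ => BE (row i e1))).
  rewrite [X in _ + X](eq_bigr _ (fun i _ => BE (row i e2))).
  by rewrite !sum_inner_rows eE mulmxDr mxtraceD.
have splitr X : \sum_i T X (row i e) = \sum_i T X (row i e1) + \sum_i T X (row i e2).
  by rewrite !(eq_bigr _ (fun i _ => symT X _)) split.
under eq_bigr => i _ do rewrite splitr.
rewrite big_split /= ![\sum_(i < k) \sum_j _]exchange_big /=.
under eq_bigr => i _ do rewrite split.
under [X in _ + X = _]eq_bigr => i _ do rewrite split.
rewrite !big_split /= mulrDl !mul1r.
have -> : \sum_(i < k1) \sum_(i0 < k2) T (row i0 e2) (row i e1) =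
   \sum_i \sum_j T (row i e1) (row j e2).
  by apply: eq_bigr => i _; apply: eq_bigr => j _; rewrite symT.
have -> : \sum_(i < k2) \sum_(i0 < k1) T (row i0 e1) (row i e2) =
   \sum_i \sum_j T (row i e1) (row j e2) by rewrite exchange_big.
have -> : \sum_(i < k1) \sum_(i0 < k1) T (row i0 e1) (row i e1) =
   \sum_i \sum_j T (row i e1) (row j e1) by rewrite exchange_big.
have -> : \sum_(i < k2) \sum_(i0 < k2) T (row i0 e2) (row i e2) =
   \sum_i \sum_j T (row i e2) (row j e2) by rewrite exchange_big.
ring.
Qed.

Section CurvatureQuadratic.
Context {m : nat} {O : set 'rV[R]_m}.
Variables (G : 'rV[R]_m -> 'M[R]_m) (y : 'rV[R]_m).
Hypotheses (metG : smooth_metric O G) (Oy : O y).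

Definition curvature_quadratic (X Y : 'rV[R]_m) : R :=
  inner (G y) (curvature G X Y Y y) X.

Let Rm (X Y : 'rV[R]_m) : 'M[R]_m := \sum_i \sum_j (X 0 i * Y 0 j) *: riemann_mx G i j y.

Let RmN (X Y : 'rV[R]_m) : Rm Y X = - Rm X Y.
Proof.
rewrite /Rm exchange_big /= -sumrN; apply: eq_bigr => i _; rewrite -sumrN.
by apply: eq_bigr => j _; rewrite riemann_mxN scalerN mulrC.
Qed.

Let Rm_skew (X Y : 'rV[R]_m) : (Rm X Y *m G y)^T = - (Rm X Y *m G y).
Proof.
rewrite /Rm mulmx_suml linear_sum -sumrN; apply: eq_bigr => i _.
rewrite mulmx_suml linear_sum -sumrN; apply: eq_bigr => j _.
by rewrite -scalemxAl linearZ /= (riemann_mx_skew metG _ _ Oy) scalerN.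
Qed.

(** The two antisymmetries of the curvature tensor, in the first and in the last pair of
    arguments, cancel each other. *)
Lemma curvature_quadraticC X Y : curvature_quadratic X Y = curvature_quadratic Y X.
Proof.
rewrite /curvature_quadratic !(curvatureE metG) // -/(Rm X Y) -/(Rm Y X) (RmN X Y) /inner.
rewrite -(mulmxA Y) [LHS]entry_tr11 trmx_mul trmxK (trmx_mul Y) Rm_skew.
by rewrite mulmxN !mulNmx mulmxN !mulmxA.
Qed.

Lemma curvature_quadraticXX X : curvature_quadratic X X = 0.
Proof.
rewrite /curvature_quadratic (curvatureE metG) // -/(Rm X X).
have /eqP : Rm X X = - Rm X X by exact: RmN.
rewrite -subr_eq0 opprK -mulr2n -scaler_nat scaler_eq0 pnatr_eq0 /= => /eqP ->.
by rewrite /inner mulmx0 !mul0mx mxE.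
Qed.

Lemma curvature_quadratic_form Y :
  exists B, forall X, curvature_quadratic X Y = inner B X X.
Proof.
pose A := \matrix_i (Y *m (\sum_j Y 0 j *: riemann_mx G i j y)).
exists (A *m G y) => X; rewrite /curvature_quadratic (curvatureE metG) // /inner mulmxA.
suff -> : X *m A = Y *m Rm X Y by [].
rewrite mulmx_sum_row mulmx_sumr; apply: eq_bigr => i _; rewrite rowK scalemxAr.
by rewrite scaler_sumr; congr (_ *m _); apply: eq_bigr => j _; rewrite scalerA.
Qed.

End CurvatureQuadratic.

End SectionalSums.

(** * The second fundamental form of an immersion *)

Section GaussVectors.
Context {R : realType} {n m : nat}.
Variables (U : set 'rV[R]_n) (O : set 'rV[R]_m) (h : 'rV[R]_n -> 'rV[R]_m)
  (G : 'rV[R]_m -> 'M[R]_m) (g : 'rV[R]_n -> 'M[R]_n).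
Hypotheses (oU : open U) (metG : smooth_metric O G) (Sh : smooth_mx U h)
  (hU : forall u, U u -> O (h u))
  (iso : forall u, U u -> g u = jac h u *m G (h u) *m (jac h u)^T).

Definition sff_vec u (X Y : 'rV[R]_n) : 'rV[R]_m :=
  Y *m \sum_a X 0 a *: sff_mx G g h a u.

Lemma sff_vecC u X Y : U u -> sff_vec u X Y = sff_vec u Y X.
Proof.
move=> Uu; apply/rowP => k; rewrite /sff_vec !mxE.
under eq_bigr => b _ do rewrite summxE mulr_sumr.
rewrite exchange_big /=; apply: eq_bigr => a _; rewrite summxE mulr_sumr.
apply: eq_bigr => b _; rewrite [X in _ * X = _]mxE [X in _ = _ * X]mxE mulrCA.
by rewrite (sff_mxC oU metG Sh hU iso).
Qed.

Lemma sff_vec_sum k u (e : 'M[R]_(k, n)) (c : 'rV[R]_k) Y :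
  sff_vec u Y (c *m e) = \sum_i c 0 i *: sff_vec u Y (row i e).
Proof.
rewrite /sff_vec (mulmx_sum_row c) mulmx_suml; apply: eq_bigr => i _.
by rewrite -scalemxAl.
Qed.

Lemma sff_vec_form u k : exists B, forall X, sff_vec u X X 0 k = inner B X X.
Proof.
exists (\matrix_(a, b) sff_mx G g h a u b k) => X.
rewrite /sff_vec /inner !mxE; apply: eq_bigr => b _.
rewrite [in RHS]mxE [X in _ = _ * X]mxE mulrC summxE; congr (_ * _).
by apply: eq_bigr => a _; rewrite !mxE.
Qed.

Lemma gauss_vec u X Y Z V : U u -> g u \in unitmx ->
  inner (G (h u))
    (curvature G (X *m jac h u) (Y *m jac h u) (Z *m jac h u) (h u))
    (V *m jac h u) =
  (Z *m (\sum_a \sum_b (X 0 a * Y 0 b) *: intrinsic_riemann g a b u) *m V^T) 0 0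
  - inner (G (h u)) (sff_vec u Y Z) (sff_vec u X V)
  + inner (G (h u)) (sff_vec u X Z) (sff_vec u Y V).
Proof.
move=> Uu gu; rewrite (curvatureE metG); last exact: hU.
have -> : \sum_i \sum_j ((X *m jac h u) 0 i * (Y *m jac h u) 0 j) *:
     riemann_mx G i j (h u) =
   \sum_a \sum_b (X 0 a * Y 0 b) *: pullback_riemann G h a b u.
  have E a b : (X 0 a * Y 0 b) *: pullback_riemann G h a b u = \sum_i \sum_j
      ((X 0 a * jac h u a i) * (Y 0 b * jac h u b j)) *: riemann_mx G i j (h u).
    rewrite /pullback_riemann scaler_sumr; apply: eq_bigr => i _.
    by rewrite scaler_sumr; apply: eq_bigr => j _; rewrite scalerA mulrACA.
  under [RHS]eq_bigr => a _ do under eq_bigr => b _ do rewrite E.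
  under [RHS]eq_bigr => a _ do rewrite exchange_big.
  rewrite [RHS]exchange_big; apply: eq_bigr => i _ /=.
  under [RHS]eq_bigr => a _ do rewrite exchange_big.
  rewrite [RHS]exchange_big; apply: eq_bigr => j _ /=.
  rewrite [(X *m _) 0 i]mxE [(Y *m _) 0 j]mxE mulr_suml scaler_suml.
  apply: eq_bigr => a _.
  by rewrite mulr_sumr scaler_suml.
rewrite /inner trmx_mul.
have -> : Z *m jac h u *m (\sum_a \sum_b (X 0 a * Y 0 b) *: pullback_riemann G h a b u) *m
    G (h u) *m ((jac h u)^T *m V^T) =
  Z *m (\sum_a \sum_b (X 0 a * Y 0 b) *: (jac h u *m pullback_riemann G h a b u *m G (h u)
    *m (jac h u)^T)) *m V^T.
  rewrite mulmxA; congr (_ *m _); rewrite -!mulmxA; congr (_ *m _).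
  rewrite mulmx_suml mulmx_sumr; apply: eq_bigr => a _.
  rewrite mulmx_suml mulmx_sumr; apply: eq_bigr => b _.
  by rewrite -scalemxAl -scalemxAr !mulmxA.
have E a b := gauss_equation oU metG Sh hU iso a b Uu gu.
under eq_bigr => a _ do under eq_bigr => b _ do rewrite E.
have F : \sum_a \sum_b (X 0 a * Y 0 b) *: (sff_mx G g h b u *m G (h u)
     *m (sff_mx G g h a u)^T) = (\sum_b Y 0 b *: sff_mx G g h b u) *m G (h u) *m
     (\sum_a X 0 a *: sff_mx G g h a u)^T.
  rewrite [(\sum_a X 0 a *: _)^T]linear_sum mulmx_sumr; apply: eq_bigr => a _.
  rewrite !mulmx_suml; apply: eq_bigr => b _.
  by rewrite linearZ /= -!scalemxAl -scalemxAr scalerA mulrC.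
have F' : \sum_a \sum_b (X 0 a * Y 0 b) *: (sff_mx G g h a u *m G (h u)
     *m (sff_mx G g h b u)^T) = (\sum_a X 0 a *: sff_mx G g h a u) *m G (h u) *m
     (\sum_b Y 0 b *: sff_mx G g h b u)^T.
  rewrite !mulmx_suml; apply: eq_bigr => a _.
  rewrite linear_sum mulmx_sumr; apply: eq_bigr => b _.
  by rewrite linearZ /= -!scalemxAl -scalemxAr scalerA.
have -> : \sum_a \sum_b (X 0 a * Y 0 b) *: (intrinsic_riemann g a b u
      - sff_mx G g h b u *m G (h u) *m (sff_mx G g h a u)^T
      + sff_mx G g h a u *m G (h u) *m (sff_mx G g h b u)^T) =
   \sum_a \sum_b (X 0 a * Y 0 b) *: intrinsic_riemann g a b u
   - \sum_a \sum_b (X 0 a * Y 0 b) *: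
       (sff_mx G g h b u *m G (h u) *m (sff_mx G g h a u)^T)
   + \sum_a \sum_b (X 0 a * Y 0 b) *:
       (sff_mx G g h a u *m G (h u) *m (sff_mx G g h b u)^T).
  rewrite -sumrB -big_split; apply: eq_bigr => a _; rewrite -sumrB -big_split.
  by apply: eq_bigr => b _; rewrite scalerDr scalerBr.
rewrite F F' /sff_vec !trmx_mul.
rewrite mulmxDr mulmxBr !mulmxDl mulNmx [LHS]mxE [X in X + _]mxE [X in _ + X + _]mxE.
by rewrite !mulmxA.
Qed.

End GaussVectors.

Section ImmersionAtPoint.
Context {R : realType} {n m : nat} {M : atlas R n} {N : atlas R m}.

Lemma open_loc_dom (x : M -> N) (a : chart_index M) (b : chart_index N) :
  open (img a) -> (forall u, img a u -> {for u, continuous (param a)}) ->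
  continuous x -> open (dom b) -> open (loc_dom x a b).
Proof.
move=> oI cp cx od; rewrite openE => u [Iu du].
have nI : nbhs u (img a) by exact: open_nbhs_nbhs.
have nd : nbhs u ((x \o param a) @^-1` dom b).
  have c : {for u, continuous (x \o param a)}.
    by apply: continuous_comp; [exact: cp|exact: cx].
  by apply: c; exact: open_nbhs_nbhs.
by apply: filterS (filterI nI nd) => w [].
Qed.

Lemma smooth_loc (x : M -> N) (a : chart_index M) (b : chart_index N) :
  smooth_map x -> smooth_mx (loc_dom x a b) (loc x a b).
Proof. by move=> [_ Sx] i j; rewrite ord1; exact: Sx. Qed.

Lemma loc_img (x : M -> N) (a : chart_index M) (b : chart_index N) u :
  loc_dom x a b u -> img b (loc x a b u).
Proof. by move=> [_ du]; exists (x (param a u)). Qed.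

(** Extending [Y] by constant coordinates turns both covariant derivatives into
    products with [Y], whose difference is [sff_mx]. *)
Lemma second_fundamental_formE (x : M -> N) (p : M) X Y :
  let a := chart_at p in let b := chart_at (x p) in
  open (loc_dom x a b) -> loc_dom x a b (coord_at p) -> smooth_map x ->
  riemannian_manifold N -> (gram_at p)^T = gram_at p ->
  second_fundamental_form x p X Y =
  sff_vec (loc x a b) (gram b) (gram a) (coord_at p) X Y.
Proof.
move=> a b oU Uu Sx hN sg; set u := coord_at p in Uu *.
have metG := chart_metric b hN; have [_ _ pG] := metG.
have [sG _] := pG _ (loc_img Uu).
have Sh := smooth_loc a b Sx.
rewrite /second_fundamental_form -/a -/b nabla_cst //.
have dJ := smooth_mx_is_mderive X oU Uu (smooth_jac oU Sh).
have dV := is_mderiveM (is_mderive_cst u X Y) dJ; rewrite mul0mx add0r in dV.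
rewrite (nablaE sG dV) /sff_vec /differential -/a -/b -/u.
have -> : \sum_i (X *m jac (loc x a b) u) 0 i *: connection_mx (gram b) i (loc x a b u) =
   \sum_c X 0 c *: pullback_connection (gram b) (loc x a b) c u.
  rewrite pullback_connection.unlock.
  under [RHS]eq_bigr => c _ do rewrite scaler_sumr.
  rewrite [RHS]exchange_big; apply: eq_bigr => i _ /=.
  rewrite [(X *m _) 0 i]mxE scaler_suml.
  by apply: eq_bigr => c _; rewrite scalerA.
rewrite -!mulmxA -mulmxDr -mulmxBr; congr (_ *m _).
rewrite mulmx_sumr mulmx_suml -big_split -sumrB; apply: eq_bigr => c _.
by rewrite sff_mx.unlock jac_derivative.unlock scalerBr scalerDr -scalemxAl -scalemxAr.
Qed.

End ImmersionAtPoint.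

(** * Orthonormal bases of leaves and fibres *)

Section OrthonormalBases.
Context {R : realType}.

Lemma onb_orthonormal n k (M : atlas R n) (p : M) (W : 'M[R]_(k, n)) :
  posdef (gram_at p) -> orthonormal_basis (gram_at p) (onb p W).
Proof. by move=> pG; apply: xgetPex; exact: orthonormal_basis_exists. Qed.

Lemma orthonormal_full n (G : 'M[R]_n) (e : 'M[R]_(\rank (1%:M : 'M[R]_n), n)) :
  G \in unitmx -> orthonormal_basis G e -> e^T *m e = invmx G.
Proof.
move=> uG [eG eW]; apply: orthonormal_gram_inv uG _ eG.
by rewrite -sub1mx eW.
Qed.

Lemma orthonormal_leaf n1 n2 (A : 'M[R]_n1) (B : 'M[R]_n2)
    (e : 'M[R]_(\rank (leaf_space R n1 n2), n1 + n2)) :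
  A \in unitmx -> orthonormal_basis (block_mx A 0 0 B) e ->
  exists a : 'M[R]_(_, n1),
    [/\ e = row_mx a 0, a *m A *m a^T = 1%:M & a^T *m a = invmx A].
Proof.
move=> uA [eG eW].
have /submxP[a ea] : (e <= leaf_space R n1 n2)%MS by rewrite eW.
have {}ea : e = row_mx a 0 by rewrite ea mul_mx_row mulmx1 mulmx0.
have aA : a *m A *m a^T = 1%:M.
  rewrite -eG ea mul_row_block !mul0mx !mulmx0 !addr0 tr_row_mx mul_row_col.
  by rewrite mul0mx addr0.
exists a; split=> //; apply: orthonormal_gram_inv uA _ aA.
have /submxP[D] : (leaf_space R n1 n2 <= e)%MS by rewrite eW.
rewrite ea mul_mx_row => /eq_row_mx[Da _].
by apply/row_fullP; exists D.
Qed.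

Lemma orthonormal_fibre n1 n2 (A : 'M[R]_n1) (B : 'M[R]_n2)
    (e : 'M[R]_(\rank (fibre_space R n1 n2), n1 + n2)) :
  B \in unitmx -> orthonormal_basis (block_mx A 0 0 B) e ->
  exists b : 'M[R]_(_, n2),
    [/\ e = row_mx 0 b, b *m B *m b^T = 1%:M & b^T *m b = invmx B].
Proof.
move=> uB [eG eW].
have /submxP[b eb] : (e <= fibre_space R n1 n2)%MS by rewrite eW.
have {}eb : e = row_mx 0 b by rewrite eb mul_mx_row mulmx1 mulmx0.
have bB : b *m B *m b^T = 1%:M.
  rewrite -eG eb mul_row_block !mul0mx !mulmx0 !add0r tr_row_mx mul_row_col.
  by rewrite mul0mx add0r.
exists b; split=> //; apply: orthonormal_gram_inv uB _ bB.
have /submxP[D] : (fibre_space R n1 n2 <= e)%MS by rewrite eW.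
rewrite eb mul_mx_row => /eq_row_mx[_ Db].
by apply/row_fullP; exists D.
Qed.

Lemma rank_fibre_space n1 n2 : \rank (fibre_space R n1 n2) = n2.
Proof.
apply/eqP; apply/row_freeP; exists (col_mx 0 1%:M).
by rewrite mul_row_col mul0mx mulmx1 add0r.
Qed.

Lemma orthonormal_inner n k (G : 'M[R]_n) (e : 'M[R]_(k, n)) i j :
  e *m G *m e^T = 1%:M -> inner G (row i e) (row j e) = (i == j)%:R.
Proof.
move=> /matrixP /(_ i j); rewrite [RHS]mxE => <-.
rewrite /inner -row_mul mxE [RHS]mxE; apply: eq_bigr => l _.
by congr (_ * _); rewrite !mxE.
Qed.

End OrthonormalBases.

Section TraceScaling.
Context {R : realType} {n m : nat} {M : atlas R n} {N : atlas R m}.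

(** For [k = 0], where the factors do not cancel, the trace is an empty sum. *)
Lemma scale_sff_trace k (x : M -> N) (p : M) (W : 'M[R]_(k, n)) :
  k%:R *: (k%:R^-1 *: sff_trace x p W) = sff_trace x p W.
Proof.
case: k W => [|k] W; last by rewrite scalerA mulfV ?scale1r // pnatr_eq0.
rewrite scale0r /sff_trace big1 // => i _.
by have := leq_trans (ltn_ord i) (rank_leq_row W); rewrite ltn0.
Qed.

(** On an orthonormal pair the denominator of the sectional curvature is [1], as the
    differential is isometric. *)
Lemma double_ambient_tau k (x : M -> N) (p : M) (W : 'M[R]_(k, n)) :
  riemannian_manifold N -> posdef (gram_at p) ->
  gram_at p = differential x p *m gram_at (x p) *m (differential x p)^T ->
  2 * ambient_tau x p W = \sum_i \sum_j
    curvature_quadratic (gram (chart_at (x p))) (coord_at (x p))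
      (row i (onb p W) *m differential x p) (row j (onb p W) *m differential x p).
Proof.
move=> hN pG iso.
have metG := chart_metric (chart_at (x p)) hN.
have Ixp := coord_at_img (x p) (proj1 hN).
rewrite sum_pairs.
- congr (_ * _); apply: eq_bigr => i _; apply: eq_bigr => j ij.
  have [eG _] := onb_orthonormal W pG.
  rewrite /sectional_curvature -!inner_pullback -iso !(orthonormal_inner _ _ eG).
  have -> : (i == j) = false by exact: ltn_eqF ij.
  by rewrite !eqxx expr0n subr0 mulr1 divr1.
- by move=> i j; rewrite (curvature_quadraticC metG Ixp).
- by move=> i; rewrite (curvature_quadraticXX metG Ixp).
Qed.

End TraceScaling.

Section MixedCurvature.
Context {R : realType} {n1 n2 : nat}.
Variables (U1 : set 'rV[R]_n1) (U2 : set 'rV[R]_n2) (G1 : 'rV[R]_n1 -> 'M[R]_n1)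
  (G2 : 'rV[R]_n2 -> 'M[R]_n2) (phi : 'rV[R]_n1 -> R).
Hypotheses (metG1 : smooth_metric U1 G1) (oU2 : open U2)
  (pG2 : forall y, U2 y -> posdef (G2 y)) (Sphi : smooth_on U1 phi)
  (phi_gt0 : forall y, U1 y -> 0 < phi y).

(** A leaf vector and a fibre vector select the lower left block, where the Hessian
    and the fibre metric factor. *)
Lemma intrinsic_riemann_mixed u (X : 'rV[R]_n1) (Y : 'rV[R]_n2) :
  U1 (lsubmx u) -> U2 (rsubmx u) ->
  (row_mx 0 Y *m (\sum_a \sum_b
     ((row_mx X (0 : 'rV[R]_n2)) 0 a * (row_mx (0 : 'rV[R]_n1) Y) 0 b) *:
     intrinsic_riemann (warped_metric G1 G2 phi) a b u) *m (row_mx X 0)^T) 0 0 =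
  - phi (lsubmx u) * inner (hessian_mx G1 phi (lsubmx u)) X X * inner (G2 (rsubmx u)) Y Y.
Proof.
move=> U1u U2u.
have blk (A : 'M[R]_(n1 + n2)) :
    row_mx 0 Y *m A *m (row_mx X 0)^T = Y *m dlsubmx A *m X^T.
  rewrite -{1}(submxK A) mul_row_block !mul0mx !add0r tr_row_mx mul_row_col.
  by rewrite trmx0 mulmx0 addr0.
rewrite blk.
have -> : dlsubmx (\sum_a \sum_b
     ((row_mx X (0 : 'rV[R]_n2)) 0 a * (row_mx (0 : 'rV[R]_n1) Y) 0 b) *:
     intrinsic_riemann (warped_metric G1 G2 phi) a b u) =
   - phi (lsubmx u) *: ((Y *m G2 (rsubmx u))^T *m (X *m hessian_mx G1 phi (lsubmx u))).
  rewrite big_split_ord /= [X in _ + X]big1 ?addr0; last first.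
    by move=> a _; rewrite big1 // => b _; rewrite row_mxEr mxE mul0r scale0r.
  have E i : \sum_b ((row_mx X (0 : 'rV[R]_n2)) 0 (lshift n2 i)
                     * (row_mx (0 : 'rV[R]_n1) Y) 0 b) *:
       intrinsic_riemann (warped_metric G1 G2 phi) (lshift n2 i) b u =
     \sum_j (X 0 i * Y 0 j) *:
       intrinsic_riemann (warped_metric G1 G2 phi) (lshift n2 i) (rshift n1 j) u.
    rewrite big_split_ord /= [X in X + _]big1 ?add0r; last first.
      move=> b _; have -> : (row_mx 0 Y : 'rV[R]_(n1 + n2)) 0 (lshift n2 b) = 0.
        by rewrite row_mxEl mxE.
      by rewrite mulr0 scale0r.
    by apply: eq_bigr => j _; rewrite row_mxEl row_mxEr.
  rewrite (eq_bigr _ (fun i _ => E i)).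
  have dlS (I : finType) (F : I -> 'M[R]_(n1 + n2)) :
      dlsubmx (\sum_i F i) = \sum_i dlsubmx (F i).
    by apply/matrixP => a b; rewrite !mxE !summxE; apply: eq_bigr => i _; rewrite !mxE.
  have trZ c (A : 'rV[R]_n2) : (c *: A)^T = c *: A^T by rewrite linearZ.
  have dlZ c (A : 'M[R]_(n1 + n2)) : dlsubmx (c *: A) = c *: dlsubmx A.
    by apply/matrixP => a b; rewrite !mxE.
  rewrite dlS (mulmx_sum_row X) mulmx_sumr scaler_sumr; apply: eq_bigr => i _.
  rewrite dlS (mulmx_sum_row Y) linear_sum mulmx_suml scaler_sumr; apply: eq_bigr => j _.
  rewrite dlZ (intrinsic_riemann_warped metG1 oU2 pG2 Sphi phi_gt0) //.
  rewrite /= rowK trZ -scalemxAr -scalemxAl !scalerA; congr (_ *: _); ring.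
rewrite -scalemxAr -scalemxAl mxE -mulrA; congr (_ * _).
rewrite !mulmxA -(mulmxA _ X) -(mulmxA _ (X *m _)) mxE big_ord1 mulrC; congr (_ * _).
by rewrite [LHS]entry_tr11 trmx_mul trmxK.
Qed.

End MixedCurvature.

(** * Immersions of warped products *)

Section WarpedCharts.
Context {R : realType} {n1 n2 : nat} {M1 : atlas R n1} {M2 : atlas R n2} {f : M1 -> R}.
Local Notation W := (warped_product M1 M2 f).

Lemma img_warped (a : chart_index W) :
  img a = [set u | img a.1 (lsubmx u) /\ img a.2 (rsubmx u)].
Proof.
apply/seteqP; split => u.
  move=> [q [d1 d2] <-] /=; rewrite row_mxKl row_mxKr.
  by split; [exists q.1|exists q.2].
move=> [[q1 d1 E1] [q2 d2 E2]]; exists (q1, q2) => //=.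
by rewrite E1 E2 hsubmxK.
Qed.

Lemma open_img_warped (a : chart_index W) :
  open (img a.1) -> open (img a.2) -> open (img a).
Proof. by rewrite img_warped; exact: open_split_domain. Qed.

Lemma continuous_param_warped (a : chart_index W) u :
  smooth_manifold M1 -> smooth_manifold M2 -> img a u -> {for u, continuous (param a)}.
Proof.
move=> [_ _ charts1 _ _] [_ _ charts2 _ _]; rewrite img_warped => -[I1 I2].
have [_ _ _ _ c1] := charts1 a.1; have [_ _ _ _ c2] := charts2 a.2.
have C1 : param a.1 (lsubmx w) @[w --> u] --> param a.1 (lsubmx u).
  apply: (@continuous_comp _ _ _ (lsubmx : 'rV[R]_(n1 + n2) -> 'rV[R]_n1) (param a.1)).
    exact: continuous_lsubmx.
  exact: c1.
have C2 : param a.2 (rsubmx w) @[w --> u] --> param a.2 (rsubmx u).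
  apply: (@continuous_comp _ _ _ (rsubmx : 'rV[R]_(n1 + n2) -> 'rV[R]_n2) (param a.2)).
    exact: continuous_rsubmx.
  exact: c2.
exact: (cvg_pair C1 C2).
Qed.

Lemma param_coord_at_warped (p : W) : smooth_manifold M1 -> smooth_manifold M2 ->
  param (chart_at p) (coord_at p) = p.
Proof.
move=> h1 h2; rewrite /coord_at /= row_mxKl row_mxKr -!/(coord_at _) !param_coord_at //.
by case: p.
Qed.

End WarpedCharts.

Section WarpedImmersion.
Context {R : realType} {n1 n2 m : nat} {M1 : atlas R n1} {M2 : atlas R n2} {N : atlas R m}
  {f : M1 -> R}.
Hypotheses (hM1 : riemannian_manifold M1) (hM2 : riemannian_manifold M2)
  (hN : riemannian_manifold N) (hf : smooth_function f) (f_gt0 : forall q : M1, 0 < f q).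
Variable x : warped_product M1 M2 f -> N.
Hypothesis hx : isometric_immersion x.
Local Notation W := (warped_product M1 M2 f).

Section AtPoint.
Variable p : W.
Let a := chart_at p.
Let b := chart_at (x p).
Let u := coord_at p.
Let h := loc x a b.
Local Notation leaf := (leaf_space R n1 n2).
Local Notation fibre := (fibre_space R n1 n2).
Local Notation sff := (second_fundamental_form x p).
Local Notation gN := (inner (gram_at (x p))).
Local Notation tau := (ambient_tau x p).
Local Notation tr := (sff_trace x p).

Let met1 := chart_metric (chart_at p.1) hM1.
Let met2 := chart_metric (chart_at p.2) hM2.
Let metN := chart_metric b hN.
Let phi := f \o param (chart_at p.1).

Let oU : open (loc_dom x a b).
Proof.
have [[cx _] _] := proj1 hx.
apply: open_loc_dom => //.
- by apply: open_img_warped; [case: met1|case: met2].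
- by move=> w; apply: continuous_param_warped; [case: hM1|case: hM2].
- by have [[_ _ charts _ _] _] := hN; have [] := charts b.
Qed.

Let pu : param a u = p.
Proof. by apply: param_coord_at_warped; [case: hM1|case: hM2]. Qed.

Let U1u : img (chart_at p.1) (lsubmx u).
Proof. by rewrite row_mxKl; apply: coord_at_img; case: hM1. Qed.

Let U2u : img (chart_at p.2) (rsubmx u).
Proof. by rewrite row_mxKr; apply: coord_at_img; case: hM2. Qed.

Let Uu : loc_dom x a b u.
Proof.
split; first by rewrite img_warped.
by rewrite pu; have [[_ _ _ + _] _] := hN; apply.
Qed.

Let hu : h u = coord_at (x p).
Proof. by rewrite /h /loc pu. Qed.

Let iso w : loc_dom x a b w ->
  gram a w = jac h w *m gram b (h w) *m (jac h w)^T.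
Proof. by move=> Uw; case: hx => _; exact. Qed.

Let iso_at : gram_at p = differential x p *m gram_at (x p) *m (differential x p)^T.
Proof. by rewrite /gram_at -/b -hu; exact: iso. Qed.

Let posN : posdef (gram_at (x p)). Proof. exact: posdef_gram_at. Qed.

Let posp : posdef (gram_at p).
Proof. by rewrite iso_at; apply: posdef_pullback posN _; case: hx => -[]. Qed.

Let gu : gram a u \in unitmx. Proof. exact: posdef_unit posp. Qed.

Let phi_gt0 y : img (chart_at p.1) y -> 0 < phi y. Proof. by move=> _; exact: f_gt0. Qed.

Let pG1 : posdef (gram (chart_at p.1) (lsubmx u)).
Proof. by case: met1 => _ _; apply. Qed.

Let pG2 : posdef (gram (chart_at p.2) (rsubmx u)).
Proof. by case: met2 => _ _; apply. Qed.

Let phi_u : phi (lsubmx u) = f p.1.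
Proof. by rewrite /phi /= row_mxKl; congr f; apply: param_coord_at; case: hM1. Qed.

Let Sphi : smooth_on (img (chart_at p.1)) phi. Proof. exact: hf. Qed.

Lemma sffE X Y : sff X Y = sff_vec h (gram b) (gram a) u X Y.
Proof.
apply: second_fundamental_formE => //; first by case: hx => -[].
by case: posp.
Qed.

Lemma sffC X Y : sff X Y = sff Y X.
Proof.
rewrite !sffE; apply: (sff_vecC oU metN) Uu; last exact: iso.
  by apply: smooth_loc; case: hx => -[].
exact: loc_img.
Qed.

Let E := onb p (1%:M : 'M[R]_(n1 + n2)).
Let e1 := onb p leaf.
Let e2 := onb p fibre.

Let f2G2_unit : phi (lsubmx u) ^+ 2 *: gram (chart_at p.2) (rsubmx u) \in unitmx.
Proof.
rewrite unitmxZ ?(posdef_unit pG2) // unitfE expf_neq0 // gt_eqF //.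
exact: phi_gt0 U1u.
Qed.

(** Both sides are the inverse of the metric, which is block diagonal.  Hence the three
    orthonormal bases, chosen independently of each other, behave in traces as if the
    first one were the union of the other two. *)
Lemma onb_gram_split : E^T *m E = e1^T *m e1 + e2^T *m e2.
Proof.
have [c1 [e1E _ c1G]] := orthonormal_leaf (posdef_unit pG1) (onb_orthonormal leaf posp).
have [c2 [e2E _ c2G]] := orthonormal_fibre f2G2_unit (onb_orthonormal fibre posp).
rewrite (orthonormal_full gu (onb_orthonormal _ posp)) /e1 /e2 e1E e2E.
rewrite (invmx_block_diag gu) -c1G -c2G !tr_row_mx !mul_col_row !trmx0 !(mul0mx, mulmx0).
by rewrite add_block_mx !(addr0, add0r).
Qed.

Lemma sff_trace_split : tr (1%:M : 'M[R]_(n1 + n2)) = tr leaf + tr fibre.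
Proof.
apply/rowP => k; rewrite mxE /sff_trace !summxE.
have [B BE] := sff_vec_form h (gram b) (gram a) u k.
have S l (e : 'M[R]_(l, n1 + n2)) :
    \sum_i (sff (row i e) (row i e)) 0 k = \tr (B *m (e^T *m e)).
  by rewrite -sum_inner_rows; apply: eq_bigr => i _; rewrite sffE BE.
by rewrite !S onb_gram_split mulmxDr mxtraceD.
Qed.

Let T X Y := curvature_quadratic (gram b) (coord_at (x p))
  (X *m differential x p) (Y *m differential x p).

(** Only the pairs with one vector in each distribution survive. *)
Lemma ambient_tau_split :
  tau (1%:M : 'M[R]_(n1 + n2)) - tau leaf - tau fibre =
  \sum_i \sum_j T (row i e1) (row j e2).
Proof.
have Ixp := coord_at_img (x p) (proj1 hN).
have tauE k (V : 'M[R]_(k, n1 + n2)) : 2 * tau V =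
    \sum_i \sum_j T (row i (onb p V)) (row j (onb p V))
  := double_ambient_tau V hN posp iso_at.
have symT X Y : T X Y = T Y X by exact: (curvature_quadraticC metN Ixp).
have quadT Y : exists B, forall X, T X Y = inner B X X.
  have [B BE] := curvature_quadratic_form metN Ixp (Y *m differential x p).
  exists (differential x p *m B *m (differential x p)^T) => X.
  by rewrite inner_pullback -BE.
have := sum_inner_quadratic_split onb_gram_split symT quadT.
rewrite -!tauE -!mulrDr => /(mulfI _) ->; last by rewrite pnatr_eq0.
by rewrite -addrA -opprD addrC addKr.
Qed.

(** Unit vectors of the fibre have [f^2 g_2(V, V) = 1], which turns the factor [- f] of the
    Hessian into [- 1 / f]. *)
Lemma mixed_sectional_curvature i j : T (row i e1) (row j e2) =
  - (f p.1)^-1 * inner (hessian_mx (gram (chart_at p.1)) phi (lsubmx u))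
       (lsubmx (row i e1)) (lsubmx (row i e1))
  - gN (sff (row j e2) (row j e2)) (sff (row i e1) (row i e1))
  + gN (sff (row i e1) (row j e2)) (sff (row i e1) (row j e2)).
Proof.
have [c1 [e1E c1G _]] := orthonormal_leaf (posdef_unit pG1) (onb_orthonormal leaf posp).
have [c2 [e2E c2G _]] := orthonormal_fibre f2G2_unit (onb_orthonormal fibre posp).
have r1 : row i e1 = row_mx (row i c1) 0 by rewrite /e1 e1E row_row_mx row0.
have r2 : row j e2 = row_mx 0 (row j c2) by rewrite /e2 e2E row_row_mx row0.
have Sh : smooth_mx (loc_dom x a b) h by apply: smooth_loc; case: hx => -[].
have := gauss_vec oU metN Sh (@loc_img _ _ _ _ _ x a b) iso (row i e1) (row j e2)
  (row j e2) (row i e1) Uu gu.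
rewrite -!sffE (sffC (row j e2) (row i e1)) hu -[LHS]/(T (row i e1) (row j e2)) => ->.
congr (_ - _ + _); rewrite r1 r2 row_mxKl.
have oU2 : open (img (chart_at p.2)) by case: met2.
have pG2' y : img (chart_at p.2) y -> posdef (gram (chart_at p.2) y).
  by case: met2 => _ _; exact.
rewrite (intrinsic_riemann_mixed met1 oU2 pG2' Sphi phi_gt0 _ _ U1u U2u).
have c2j : f p.1 ^+ 2 * inner (gram (chart_at p.2) (rsubmx u)) (row j c2) (row j c2) = 1.
  have c := orthonormal_inner j j c2G; rewrite eqxx in c; apply: etrans c.
  by rewrite /inner -scalemxAr -scalemxAl [RHS]mxE phi_u.
have f0 : f p.1 != 0 by rewrite gt_eqF.
rewrite phi_u -[RHS]mulr1 -c2j; move: (inner _ _ _) (inner _ _ _) => A B.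
by field.
Qed.

Let H := hessian_mx (gram (chart_at p.1)) phi (lsubmx u).

Lemma mixed_curvature_sum : \sum_i \sum_j T (row i e1) (row j e2) =
  n2%:R * (laplacian f p.1 / f p.1) - gN (tr leaf) (tr fibre)
  + \sum_i \sum_j gN (sff (row i e1) (row j e2)) (sff (row i e1) (row j e2)).
Proof.
under eq_bigr => i _ do under eq_bigr => j _ do rewrite mixed_sectional_curvature.
under eq_bigr => i _ do rewrite big_split sumrB /=.
rewrite big_split sumrB /=; congr (_ - _ + _); last first.
  rewrite /sff_trace inner_suml; apply: eq_bigr => i _.
  by rewrite innerC ?inner_suml //; case: posN.
have [c1 [e1E _ c1G]] := orthonormal_leaf (posdef_unit pG1) (onb_orthonormal leaf posp).
under eq_bigr => i _ do rewrite sumr_const card_ord rank_fibre_space.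
rewrite sumrMnl -[LHS]mulr_natl -mulr_sumr; congr (_ * _).
rewrite (eq_bigr (fun i => inner H (row i c1) (row i c1))); last first.
  by move=> i _; rewrite /e1 e1E row_row_mx row_mxKl.
rewrite sum_inner_rows c1G mulNr mulrC (laplacian_hessian _ hM1 hf) mulNr.
by rewrite /H /gram_at row_mxKl.
Qed.

(** With [t_1], [t_2] the two traces, the two sides differ by
    [|t_1 + t_2|^2 / 4 - <t_1, t_2> = |t_1 - t_2|^2 / 4] plus the mixed terms. *)
Lemma deficit :
  (n1 + n2)%:R ^+ 2 / 4%:R * gN (mean_curvature x p) (mean_curvature x p)
  + tau (1%:M : 'M[R]_(n1 + n2)) - tau leaf - tau fibre
  - n2%:R * (laplacian f p.1 / f p.1) =
  4^-1 * gN (tr leaf - tr fibre) (tr leaf - tr fibre)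
  + \sum_i \sum_j gN (sff (row i e1) (row j e2)) (sff (row i e1) (row j e2)).
Proof.
have regroup (k a' b' c l : R) : k + a' - b' - c - l = k + (a' - b' - c) - l.
  by rewrite !addrA.
rewrite regroup ambient_tau_split mixed_curvature_sum.
have -> : (n1 + n2)%:R ^+ 2 / 4%:R * gN (mean_curvature x p) (mean_curvature x p) =
  4^-1 * gN (tr leaf + tr fibre) (tr leaf + tr fibre).
  rewrite -sff_trace_split -[in RHS](scale_sff_trace (k := n1 + n2)).
  rewrite -/(mean_curvature x p).
  move: (mean_curvature x p) => v; rewrite innerZl innerZr.
  by move: (inner _ _ _) ((n1 + n2)%:R) => c k; field.
set t1 := tr leaf; set t2 := tr fibre.
rewrite -[- t2]scaleN1r !(innerDl, innerDr) !(innerZl, innerZr).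
rewrite (innerC t2 t1 (proj1 posN)).
by set S := \sum_i _; move: (laplacian f p.1 / f p.1) => L; field.
Qed.

Lemma sff_mixed_vanish :
  (forall i j, sff (row i e1) (row j e2) = 0) <->
  (forall X Y : 'rV[R]_(n1 + n2), (X <= leaf)%MS -> (Y <= fibre)%MS -> sff X Y = 0).
Proof.
have [_ e1W] := onb_orthonormal leaf posp; have [_ e2W] := onb_orthonormal fibre posp.
split=> [S0 X Y|S0 i j]; last first.
  by apply: S0; rewrite -?e1W -?e2W row_sub.
rewrite -e1W -e2W => /submxP[c ->] /submxP[d ->].
have S1 i : sff (row i e1) (d *m e2) = 0.
  rewrite sffE sff_vec_sum big1 // => j _.
  by rewrite -sffE S0 scaler0.
by rewrite sffC sffE sff_vec_sum big1 // => i _; rewrite -sffE sffC S1 scaler0.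
Qed.

Lemma deficit_ge0 : 0 <=
  4^-1 * gN (tr leaf - tr fibre) (tr leaf - tr fibre)
  + \sum_i \sum_j gN (sff (row i e1) (row j e2)) (sff (row i e1) (row j e2)).
Proof.
apply: addr_ge0; first by rewrite mulr_ge0 ?invr_ge0 // posdef_ge0.
by apply: sumr_ge0 => i _; apply: sumr_ge0 => j _; exact: posdef_ge0.
Qed.

Lemma deficit_eq0 :
  4^-1 * gN (tr leaf - tr fibre) (tr leaf - tr fibre)
  + \sum_i \sum_j gN (sff (row i e1) (row j e2)) (sff (row i e1) (row j e2)) = 0 <->
  (tr leaf = tr fibre /\ forall i j, sff (row i e1) (row j e2) = 0).
Proof.
have S0 i : 0 <= \sum_j gN (sff (row i e1) (row j e2)) (sff (row i e1) (row j e2)).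
  by apply: sumr_ge0 => j _; exact: posdef_ge0.
split=> [/eqP|[-> E0]]; last first.
  rewrite subrr {1}/inner !mul0mx mxE mulr0 add0r big1 // => i _; rewrite big1 // => j _.
  by rewrite E0 /inner !mul0mx mxE.
rewrite paddr_eq0 ?sumr_ge0 //; last by rewrite mulr_ge0 ?invr_ge0 // posdef_ge0.
rewrite mulf_eq0 invr_eq0 pnatr_eq0 /= => /andP[/eqP t0 /eqP s0]; split.
  by apply/eqP; rewrite -subr_eq0; apply/eqP; exact: posdef_eq0 posN t0.
move=> i j; apply: (posdef_eq0 posN).
have /(psumr_eq0P (fun i _ => S0 i))/(_ i isT) := s0.
move/(psumr_eq0P (fun j _ => posdef_ge0 _ posN)); exact.
Qed.

End AtPoint.
End WarpedImmersion.

Theorem theorem2p2 (R : realType) (n1 n2 m : nat)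
    (M1 : atlas R n1) (M2 : atlas R n2) (N : atlas R m) (f : M1 -> R)
    (hM1 : riemannian_manifold M1) (hM2 : riemannian_manifold M2)
    (hN : riemannian_manifold N)
    (hf : smooth_function f) (f_gt0 : forall q : M1, 0 < f q)
    (x : warped_product M1 M2 f -> N) (hx : isometric_immersion x) :
  let n := (n1 + n2)%N in
  let lhs (p : warped_product M1 M2 f) :=
    n2%:R * (laplacian f p.1 / f p.1) in
  let rhs (p : warped_product M1 M2 f) :=
    n%:R ^+ 2 / 4%:R
      * inner (gram_at (x p)) (mean_curvature x p) (mean_curvature x p)
    + ambient_tau x p (1%:M : 'M[R]_n)
    - ambient_tau x p (leaf_space R n1 n2)
    - ambient_tau x p (fibre_space R n1 n2) in
  (forall p, lhs p <= rhs p) /\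
  ((forall p, lhs p = rhs p) <->
   (mixed_totally_geodesic x /\
    forall p, n1%:R *: partial_mean_curvature1 x p =
              n2%:R *: partial_mean_curvature2 x p)).
Proof.
move=> n lhs rhs.
have D p := deficit hM1 hM2 hN hf f_gt0 hx p.
have eqD p : lhs p = rhs p <->
    (sff_trace x p (leaf_space R n1 n2) = sff_trace x p (fibre_space R n1 n2) /\
     forall X Y : 'rV[R]_(n1 + n2), (X <= leaf_space R n1 n2)%MS ->
       (Y <= fibre_space R n1 n2)%MS -> second_fundamental_form x p X Y = 0).
  have := deficit_eq0 hN x p; rewrite -D -/(rhs p) -/(lhs p) => eq0.
  have mixed := sff_mixed_vanish hM1 hM2 hN hx p.
  split=> [E|[tE /mixed sE]].
    by have [|tE /mixed sE] := iffLR eq0; first by rewrite E subrr.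
  by apply/esym/eqP; rewrite -subr_eq0; apply/eqP/eq0.
split.
  move=> p; rewrite -subr_ge0 /rhs /lhs D.
  exact: deficit_ge0.
rewrite /partial_mean_curvature1 /partial_mean_curvature2.
split=> [E|[mixed traces] p].
  split=> p; last by rewrite !scale_sff_trace; have [+ _] := iffLR (eqD p) (E p).
  by have [_ +] := iffLR (eqD p) (E p); exact.
apply/eqD; split; last exact: mixed.
by have := traces p; rewrite !scale_sff_trace.
Qed.
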